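(* The random variables $M_n$ and $O_n$ satisfy the following: (i) $\mathbb{E} O_n=m_n$ for all $n\in\mathbb{N}$. (ii) If $\mathbb{E} Z=\infty$, then $(O_n-m_n)/\sqrt{m_n}$ converges in distribution, as $n\to\infty$, to a standard normal random variable. (iii) $M_n\le O_n$, and if $\mathbb{E} Z=\infty$, then $\mathbb{E}[O_n-M_n]=o(m_n)$ as $n\to\infty$. (iv) If $\mathbb{E} Z=\infty$, then $M_n/m_n\to 1$ in probability as $n\to\infty$. (v) For all $n\in\mathbb{N}$ and all $x>0$, $$\mathbb{P}\{M_n>\mathbb{E} M_n+x\}\le\left(\frac{\mathbb{E} M_n}{\mathbb{E} M_n+x}\right)^{\mathbb{E} M_n+x}e^{x}$$ and $$\mathbb{P}\{M_n<\mathbb{E} M_n-x\}\le e^{-x^2/(2\mathbb{E} M_n)}.$$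
   Context: $\mathbb{N}=\{1,2,\ldots\}$. Let $Z,Z_1,Z_2,\ldots$ be independent, identically distributed random variables taking values in $\mathbb{N}$; write $p_n=\mathbb{P}\{Z\ge n\}$ and $m_n=\sum_{t=1}^n p_t=\mathbb{E}[\min(Z,n)]$ for $n\in\mathbb{N}$. The coloring $(C_n)_{n\in\mathbb{Z}}$ is defined by $C_i=i$ for all integers $i\le 0$ and $C_n=C_{n-Z_n}$ for $n\in\mathbb{N}$. In the associated forest on $\mathbb{Z}$, each $i\le 0$ is the root of a tree, and each $n\in\mathbb{N}$ is attached to its parent $n-Z_n$. $M_n$ is the number of trees with at least one vertex attached to the root by time $n$, i.e. the number of integers $i\le 0$ such that $t-Z_t=i$ for some $t\in\{1,\ldots,n\}$ (equivalently, such that $C_t=i$ for some $t\in\{1,\ldots,n\}$). Also, $O_n=\sum_{t=1}^n\mathbf{1}_{\{Z_t\ge t\}}$. *)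

(* Defs.v *)
From HB Require Import structures.
From mathcomp Require Import all_boot all_order all_algebra finmap.
From mathcomp Require Import all_classical all_reals all_analysis.
From mathcomp Require Import measurable_realfun.

Set Implicit Arguments.
Unset Strict Implicit.
Unset Printing Implicit Defensive.

Import Order.TTheory GRing.Theory Num.Theory.
Import numFieldNormedType.Exports.

Local Open Scope classical_set_scope.
Local Open Scope ring_scope.

Section probability_notions.
Context d (T : measurableType d) (R : realType) (P : probability T R).

Definition mutually_independent d' (T' : measurableType d') (I : choiceType)
    (X : I -> {RV P >-> T'}) : Prop :=
  forall (J : {fset I}) (A : I -> set T'),
    (forall i, i \in J -> measurable (A i)) ->
    P (\bigcap_(i in [set` J]) (X i @^-1` A i)) =
    (\prod_(i <- J) P (X i @^-1` A i))%E.

Definition identically_distributed d' (T' : measurableType d') (I : Type)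
    (X : I -> {RV P >-> T'}) : Prop :=
  forall (i j : I) (A : set T'), measurable A ->
    distribution P (X i) A = distribution P (X j) A.

(* Convergence of the cdfs at every continuity point of the limiting cdf. *)
Definition cvg_in_distribution (X : nat -> {RV P >-> R})
    (mu : probability (measurableTypeR R) R) : Prop :=
  forall x : R, {for x, continuous (fun y : R => mu `]-oo, y]%classic)} ->
    cdf (X n) x @[n --> \oo] --> mu `]-oo, x]%classic.

Definition cvg_in_probability (X : nat -> {RV P >-> R}) (Y : {RV P >-> R}) :
    Prop :=
  forall eps : R, 0 < eps ->
    P [set w | eps < `|X n w - Y w|] @[n --> \oo] --> 0%E.

End probability_notions.
Arguments mutually_independent {d T R} P {d' T' I} X.
Arguments identically_distributed {d T R} P {d' T' I} X.
Arguments cvg_in_distribution {d T R} P X mu.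
Arguments cvg_in_probability {d T R} P X Y.

Section paths.
Implicit Types (z : nat -> nat) (n : nat).

(* The parent of the vertex n in the forest driven by the jumps z 1, z 2, ...
   The subtraction is that of int. *)
Definition parent z n : int := n%:Z - (z n)%:Z.

(* The roots to which some vertex has been attached by time n. *)
Definition attached_roots z n : set int :=
  [set i | i <= 0 /\ exists2 t : nat, (1 <= t <= n)%N & parent z t = i].

Lemma finite_attached_roots z n : finite_set (attached_roots z n).
Proof.
apply: (@sub_finite_set _ _ (parent z @` `I_n.+1)).
  by move=> i [_ [t /andP[_ tn] <-]]; exists t.
exact/finite_image/finite_II.
Qed.

Lemma eq_attached_roots z1 z2 n : (forall t, (t <= n)%N -> z1 t = z2 t) ->
  attached_roots z1 n = attached_roots z2 n.
Proof.
move=> z12; apply/seteqP; split=> i [i0 [t tn ti]]; split=> //; exists t => //;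
  by rewrite -ti /parent z12//; case/andP: tn.
Qed.

End paths.

(* The jumps are Z 1, Z 2, ...; the random variable Z 0 drives no vertex and is
   the generic copy of their common law. *)
Section model.
Context d (T : measurableType d) (R : realType) (P : probability T R).
Variable Z : nat -> {RV P >-> nat}.

Definition tail_prob (n : nat) : R := fine (P [set w | (n <= Z 0%N w)%N]).

Definition trunc_mean (n : nat) : R := \sum_(1 <= t < n.+1) tail_prob t.

Definition num_old (n : nat) (w : T) : R :=
  \sum_(1 <= t < n.+1) \1_[set v | (t <= Z t v)%N] w.

Definition num_trees (n : nat) (w : T) : R :=
  #|` fset_set (attached_roots (fun t => Z t w) n)|%:R.

Lemma measurable_path_fun (n : nat) (F : (nat -> nat) -> R) :
  (forall z1 z2, (forall t, (t <= n)%N -> z1 t = z2 t) -> F z1 = F z2) ->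
  measurable_fun setT (fun w => F (fun t => Z t w)).
Proof.
move=> FE _ B mB; rewrite setTI.
pose z (s : n.+1.-tuple nat) t := nth 0%N s t.
rewrite (_ : _ @^-1` B = \bigcup_(s in [set s | B (F (z s))])
    \bigcap_(i in [set: 'I_n.+1]) Z i @^-1` [set tnth s i]).
  rewrite bigcup_mkcond; apply: countable_bigcupT_measurable => [|s].
    exact: countableP.
  case: ifPn => // _; apply: fin_bigcap_measurable => [|i _].
    exact: finite_finset.
  exact: measurable_funPTI.
apply/seteqP; split=> [w /= Bw|w [s /= Bs sw]].
  exists [tuple Z i w | i < n.+1]; last by move=> i _ /=; rewrite tnth_mktuple.
  rewrite /= (FE _ (fun t => Z t w))// => t tn.
  by rewrite /z -(@tnth_nth _ _ 0%N _ (Ordinal (tn : (t < n.+1)%N))) tnth_mktuple.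
rewrite /= (FE _ (z s))// => t tn.
by rewrite (sw (Ordinal (tn : (t < n.+1)%N)))// (tnth_nth 0%N).
Qed.

Lemma measurable_num_old n : measurable_fun setT (num_old n).
Proof.
apply: measurable_sum => t; apply: measurable_indic.
rewrite (_ : [set _ | _] = Z t @^-1` [set k | (t <= k)%N])//.
exact: measurable_funPTI.
Qed.

Lemma measurable_num_trees n : measurable_fun setT (num_trees n).
Proof.
apply: (@measurable_path_fun n (fun z => #|` fset_set (attached_roots z n)|%:R)).
by move=> z1 z2 z12; rewrite (eq_attached_roots z12).
Qed.

HB.instance Definition _ n :=
  isMeasurableFun.Build _ _ _ _ (num_old n) (measurable_num_old n).
HB.instance Definition _ n :=
  isMeasurableFun.Build _ _ _ _ (num_trees n) (measurable_num_trees n).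

Definition std_old (n : nat) (w : T) : R :=
  (num_old n w - trunc_mean n) / Num.sqrt (trunc_mean n).

Definition tree_ratio (n : nat) (w : T) : R := num_trees n w / trunc_mean n.

Lemma measurable_std_old n : measurable_fun setT (std_old n).
Proof. by apply: measurable_funM => //; exact: measurable_funB. Qed.

Lemma measurable_tree_ratio n : measurable_fun setT (tree_ratio n).
Proof. exact: measurable_funM. Qed.

HB.instance Definition _ n :=
  isMeasurableFun.Build _ _ _ _ (std_old n) (measurable_std_old n).
HB.instance Definition _ n :=
  isMeasurableFun.Build _ _ _ _ (tree_ratio n) (measurable_tree_ratio n).

End model.
Arguments tail_prob {d T R} P Z.
Arguments trunc_mean {d T R} P Z.
Arguments num_old {d T R} P Z.
Arguments num_trees {d T R} P Z.
Arguments std_old {d T R} P Z.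
Arguments tree_ratio {d T R} P Z.

(* Main.v *)
Require Import Defs.
From HB Require Import structures.
From mathcomp Require Import all_boot all_order all_algebra finmap.
From mathcomp Require Import all_classical all_reals all_analysis.
From mathcomp Require Import measurable_realfun ring lra.
Set Implicit Arguments.
Unset Strict Implicit.
Unset Printing Implicit Defensive.
Import Order.TTheory GRing.Theory Num.Theory.
Import numFieldNormedType.Exports.

Local Open Scope classical_set_scope.
Local Open Scope ring_scope.

(** Write p_t = P(Z >= t), f(k) = P(Z = k) and m_n = p_1 + ... + p_n.  A root
    -j with j >= 0 is regarded as a box, and the vertex t as a ball: it falls
    into the box Z_t - t when Z_t >= t, and into no box otherwise.  Then O_n is
    the number of balls that fall into a box and M_n is the number of occupied
    boxes, so M_n <= O_n, and E O_n = m_n by linearity.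

    Central limit theorem for O_n.  The indicators of {Z_t >= t} are independent
    Bernoulli variables with parameters p_t -> 0 and with m_n -> oo.  They are
    exchanged one by one for Gaussian increments.  The test functions are the
    smoothed half-lines x |-> Phi((a - x) / sqrt r): averaging such a function
    over a centred Gaussian increment of variance s only changes r into r + s,
    so the Gaussian side of the exchange is an explicit function of r, and one
    exchange amounts to comparing two Taylor expansions of Phi
    ([gauss_smooth_step]).  The total error ([bernoulli_lindeberg]) is a constant
    times m_n ^ (-1/2) + (sum of p_t ^ 2) / m_n, and it vanishes because p_t -> 0.
    Letting r -> 0 then sandwiches the distribution function ([bernoulli_clt]).

    Mean of O_n - M_n.  The box j receives on average A_j = sum_t f(t + j) balls,
    at most p_(j+1), and it stays empty with probability
    prod_t (1 - f(t + j)) <= 1 - A_j (1 - A_j).  Hence on average at most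
    A_j p_(j+1) of its balls are in excess.  As p_j -> 0 and the A_j sum to m_n,
    the total excess is o(m_n) ([mean_num_trees_ge]).

    Tail bounds for M_n.  Whatever the sign of lam,
    E exp(lam M_n) <= exp((exp lam - 1) E M_n), because the occupation
    indicators of the boxes are negatively dependent: moving the balls of a box
    k to other boxes can only help the other boxes to be occupied
    ([prod_mean_avoid_ge], [prod_mean_expR_num_hit]).  The two bounds follow from
    Markov's inequality with exp lam = (E M_n + x) / E M_n and with
    lam = - x / E M_n.  The same exponential bounds, together with
    E M_n / m_n -> 1, give the convergence of M_n / m_n in probability.

    Only the boxes j < K are kept at first.  The path up to time n is then coded
    by n independent letters of a finite alphabet, and each mean is an iterated
    finite sum ([prod_mean], [mean_path_code]).  The number of occupied boxes
    lost in this way is at most the number of t <= n with Z_t >= t + K, whose mean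
    tends to 0 as K -> oo. *)

(** * Expectations of functions of independent finite-valued variables *)

Section product_mean.
Variables (R : realType) (I : finType).
Implicit Types (q : I -> R) (qs : seq (I -> R)) (F G : seq I -> R) (J : seq I).

(** The mean of F over words of independent letters with laws qs.  The
    recursion on the laws is what makes a one-letter-at-a-time induction
    immediate. *)
Fixpoint prod_mean qs F : R :=
  if qs is q :: qs' then \sum_i q i * prod_mean qs' (fun s => F (i :: s))
  else F [::].

Definition is_pmf q : Prop := (forall i, 0 <= q i) /\ \sum_i q i = 1.

(** Positional, since membership of a function in a list is not decidable. *)
Definition all_pmf qs : Prop := forall k, (k < size qs)%N -> is_pmf (nth (fun=> 0) qs k).

Lemma all_pmf_cons q qs : all_pmf (q :: qs) -> is_pmf q /\ all_pmf qs.
Proof. by move=> H; split=> [|k kq]; [exact: (H 0%N)|exact: (H k.+1)]. Qed.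

Lemma eq_prod_mean qs F G : F =1 G -> prod_mean qs F = prod_mean qs G.
Proof.
elim: qs F G => /= [|q qs IH] F G FG; first exact: FG.
by apply: eq_bigr => i _; congr (_ * _); apply: IH => s; exact: FG.
Qed.

Lemma prod_meanD qs F G :
  prod_mean qs (fun s => F s + G s) = prod_mean qs F + prod_mean qs G.
Proof.
elim: qs F G => //= q qs IH F G.
by rewrite -big_split; apply: eq_bigr => i _; rewrite IH mulrDr.
Qed.

Lemma prod_meanZ qs c F : prod_mean qs (fun s => c * F s) = c * prod_mean qs F.
Proof.
elim: qs F => //= q qs IH F.
by rewrite mulr_sumr; apply: eq_bigr => i _; rewrite IH mulrCA.
Qed.

Lemma prod_mean_cst qs c : all_pmf qs -> prod_mean qs (fun=> c) = c.
Proof.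
elim: qs => //= q qs IH /all_pmf_cons[[_ q1] /IH ->].
by rewrite -mulr_suml q1 mul1r.
Qed.

Lemma prod_mean_sum qs J (F : I -> seq I -> R) : all_pmf qs ->
  prod_mean qs (fun s => \sum_(j <- J) F j s) = \sum_(j <- J) prod_mean qs (F j).
Proof.
move=> pq; elim: J => [|j J IH].
  rewrite big_nil -[RHS](prod_mean_cst 0 pq).
  by apply: eq_prod_mean => s; rewrite big_nil.
rewrite big_cons -IH -prod_meanD.
by apply: eq_prod_mean => s; rewrite big_cons.
Qed.

Lemma le_prod_mean qs F G : all_pmf qs -> (forall s, F s <= G s) ->
  prod_mean qs F <= prod_mean qs G.
Proof.
elim: qs F G => [|q qs IH] F G /=; first by move=> _; exact.
move=> /all_pmf_cons[[q0 _] pq] FG; apply: ler_sum => i _.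
by apply: ler_wpM2l => //; apply: IH => // s; exact: FG.
Qed.

Lemma is_pmf_le1 q k : is_pmf q -> q k <= 1.
Proof.
by move=> [q0 <-]; rewrite (bigD1 k)//= lerDl sumr_ge0.
Qed.

(** The probability that the letter k does not occur. *)
Definition avoid_prob qs (k : I) : R := \prod_(q <- qs) (1 - q k).

Lemma avoid_prob_itv qs k : all_pmf qs -> 0 <= avoid_prob qs k <= 1.
Proof.
rewrite /avoid_prob; elim: qs => [|q qs IH]; first by rewrite big_nil ler01 lexx.
move=> /all_pmf_cons[pq /IH/andP[a0 a1]].
have q1 := is_pmf_le1 k pq; have q0 := pq.1 k.
rewrite big_cons; apply/andP; split.
  by rewrite mulr_ge0//; lra.
by rewrite mulr_ile1//; lra.
Qed.

Lemma prod_mean_avoid qs k : all_pmf qs ->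
  prod_mean qs (fun s => (k \notin s)%:R) = avoid_prob qs k.
Proof.
rewrite /avoid_prob; elim: qs => [_|q qs IH]/=; first by rewrite big_nil.
move=> /all_pmf_cons[[q0 q1] pq].
have qk : 1 - q k = \sum_(i | i != k) q i.
  by rewrite -q1 (bigD1 k)//= addrAC subrr add0r.
rewrite big_cons -(IH pq) qk (bigD1 k)//= mulr_suml.
rewrite (eq_prod_mean _ (G := fun=> 0)) => [|s]; last by rewrite inE eqxx.
rewrite prod_mean_cst// mulr0 add0r; apply: eq_bigr => i ik.
by congr (_ * _); apply: eq_prod_mean => s; rewrite inE eq_sym (negbTE ik).
Qed.

(** If H is smallest, in each letter, at the letter k, then conditioning a word
    on the absence of k increases the mean of H.  One letter at a time: with
    h i the mean of H given that the first letter is i, the claim reduces to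
    sum_(i != k) q i * (h i - h k) >= 0. *)
Lemma prod_mean_avoid_ge qs k (H : seq I -> R) : all_pmf qs ->
  (forall s1 i s2, H (s1 ++ k :: s2) <= H (s1 ++ i :: s2)) ->
  prod_mean qs H * avoid_prob qs k <=
  prod_mean qs (fun s => (k \notin s)%:R * H s).
Proof.
rewrite /avoid_prob.
elim: qs H => [|q qs IH] H; first by rewrite big_nil /= mulr1 mul1r.
move=> /= /all_pmf_cons[pq1 pq] Hk; have [q0 q1] := pq1.
rewrite big_cons; set pi := \prod_(_ <- _) _.
set h := fun i => prod_mean qs (fun s => H (i :: s)).
have hk i : h k <= h i by apply: le_prod_mean => // s; exact: (Hk [::]).
have h_avoid i : h i * pi <= prod_mean qs (fun s => (k \notin s)%:R * H (i :: s)).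
  by apply: IH => // s1 j s2; exact: (Hk (i :: s1)).
apply: (@le_trans _ _ (\sum_(i | i != k) q i * (h i * pi))); last first.
  rewrite [leRHS](bigD1 k)//= (eq_prod_mean _ (G := fun=> 0)) => [|s].
    rewrite prod_mean_cst// mulr0 add0r; apply: ler_sum => i ik.
    rewrite ler_wpM2l//; apply: le_trans (h_avoid i) _.
    by apply: le_prod_mean => // s; rewrite inE eq_sym (negbTE ik).
  by rewrite inE eqxx mul0r.
have pi0 : 0 <= pi by have /andP[] := avoid_prob_itv k pq.
rewrite mulrA; under [leRHS]eq_bigr do rewrite mulrA.
rewrite -mulr_suml ler_wpM2r// (bigD1 k)//= -/(h k).
rewrite (eq_bigr (fun i => q i * h i))//.
set S := \sum_(i | _) _.
have qS : \sum_(i | i != k) q i = 1 - q k.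
  by rewrite -q1 [in RHS](bigD1 k)//= addrAC subrr add0r.
have hS : (1 - q k) * h k <= S.
  by rewrite -qS mulr_suml; apply: ler_sum => i _; rewrite ler_wpM2l.
rewrite -subr_ge0 (_ : _ - _ = q k * (S - (1 - q k) * h k)); last by ring.
by rewrite mulr_ge0// subr_ge0.
Qed.

Definition num_hit J (s : seq I) : R := \sum_(j <- J) (j \in s)%:R.

Lemma prod_mean_num_hit J qs : all_pmf qs ->
  prod_mean qs (num_hit J) = \sum_(j <- J) (1 - avoid_prob qs j).
Proof.
move=> pq; rewrite prod_mean_sum//; apply: eq_bigr => j _.
rewrite -(prod_mean_avoid _ pq) -[X in X - _](prod_mean_cst 1 pq).
rewrite -mulN1r -prod_meanZ -prod_meanD.
by apply: eq_prod_mean => s; case: (j \in s) => /=; ring.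
Qed.

(** A letter k outside J hits nothing, so replacing it cannot lower the count. *)
Lemma le_num_hit J k s1 i s2 : k \notin J ->
  num_hit J (s1 ++ k :: s2) <= num_hit J (s1 ++ i :: s2).
Proof.
move=> kJ; rewrite /num_hit big_seq [leRHS]big_seq; apply: ler_sum => j jJ.
rewrite ler_nat !mem_cat !inE (_ : (j == k) = false) /=; last first.
  by apply: contraNF kJ => /eqP <-.
by case: (j \in s1) => //=; case: (j \in s2); rewrite ?orbT.
Qed.

(** Induction on J.  Removing k from J writes exp(lam num_hit) as
    (exp lam - (exp lam - 1) 1_{k absent}) G, where G counts the other letters.
    Both signs of lam are treated at once: (exp lam - 1) G is smallest, in each
    letter, at k, which is exactly what [prod_mean_avoid_ge] asks for.  The mean
    is thus at most a product of factors 1 + (exp lam - 1) P(j present), each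
    bounded by an exponential. *)
Lemma prod_mean_expR_num_hit J qs (lam : R) : all_pmf qs -> uniq J ->
  prod_mean qs (fun s => expR (lam * num_hit J s)) <=
  expR ((expR lam - 1) * prod_mean qs (num_hit J)).
Proof.
move=> pq; rewrite prod_mean_num_hit//.
elim: J => [_|k J IH /= /andP[kJ uJ]].
  rewrite big_nil mulr0 expR0 -[leRHS](prod_mean_cst 1 pq).
  by apply: le_prod_mean => // s; rewrite /num_hit big_nil mulr0 expR0.
have /andP[a0 a1] := avoid_prob_itv k pq.
pose G s := expR (lam * num_hit J s).
have EG0 : 0 <= prod_mean qs G.
  rewrite -[leLHS](prod_mean_cst 0 pq).
  by apply: le_prod_mean => // s; exact: expR_ge0.
have mono s1 i s2 : (expR lam - 1) * G (s1 ++ k :: s2)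
                    <= (expR lam - 1) * G (s1 ++ i :: s2).
  rewrite /G; have [l0|l0] := leP 0 lam.
    apply: ler_wpM2l; first by rewrite subr_ge0 -expR0 ler_expR.
    by rewrite ler_expR; apply: ler_wpM2l => //; exact: le_num_hit.
  apply: ler_wnM2l; first by rewrite subr_le0 expR_le1 ltW.
  by rewrite ler_expR; apply: ler_wnM2l; [exact: ltW|exact: le_num_hit].
have := @prod_mean_avoid_ge qs k (fun s => (expR lam - 1) * G s) pq mono.
rewrite prod_meanZ => corr.
rewrite (eq_prod_mean _
  (G := fun s => expR lam * G s + -1 * ((k \notin s)%:R * ((expR lam - 1) * G s)))); last first.
  move=> s; rewrite /G /num_hit big_cons mulrDr expRD.
  by case: (k \in s) => /=; rewrite ?mulr1 ?mulr0 ?expR0; ring.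
rewrite prod_meanD !prod_meanZ big_cons mulrDr expRD.
apply: (@le_trans _ _ ((1 + (expR lam - 1) * (1 - avoid_prob qs k)) * prod_mean qs G)).
  rewrite -subr_ge0; rewrite -subr_ge0 in corr.
  by apply: le_trans corr _; rewrite le_eqVlt; apply/orP; left; apply/eqP; ring.
apply: ler_pM => //; [|exact: expR_ge1Dx|exact: IH].
have := expR_ge0 lam; nra.
Qed.

End product_mean.

Section prod_mean_tuples.
Variables (R : realType) (I : finType).

(** The closed form of the mean over words of fixed length, where the
    independence of the letters shows as a product of their laws. *)
Lemma prod_meanE (q : nat -> I -> R) (F : seq I -> R) m n :
  prod_mean [seq q t | t <- iota m n] F =
  \sum_(y : n.-tuple I) (\prod_(k < n) q (m + k)%N (tnth y k)) * F y.
Proof.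
elim: n m F => [|n IH] m F.
  rewrite (bigD1 [tuple])//= big_ord0 mul1r big1 ?addr0// => y.
  by move/eqP; rewrite (tuple0 y).
rewrite (reindex (fun p : I * n.-tuple I => [tuple of p.1 :: p.2])) /=; last first.
  exists (fun y : n.+1.-tuple I => (thead y, [tuple of behead y])) => /=.
    by move=> [i y] _ /=; congr pair; apply: val_inj.
  by move=> y _; rewrite -tuple_eta.
rewrite -(pair_bigA _ (fun (i : I) (y : n.-tuple I) =>
  (\prod_(k < n.+1) q (m + k)%N (tnth [tuple of i :: y] k)) * F (i :: y)))/=.
apply: eq_bigr => i _; rewrite IH mulr_sumr; apply: eq_bigr => y _.
rewrite big_ord_recl addn0 tnth0 mulrA; congr (_ * _ * _).
by apply: eq_bigr => k _; rewrite tnthS addSnnS.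
Qed.

End prod_mean_tuples.

(** * Taylor bounds and the Gaussian distribution function *)

Section calculus.
Variable R : realType.
Implicit Types (F : R -> R) (x k C : R).

(** The mean value theorem for increments of either sign. *)
Lemma mean_value F (F1 : R -> R) x k : (forall t : R, is_derive t 1 F (F1 t)) ->
  exists2 xi, `|xi - x| <= `|k| & F (x + k) - F x = k * F1 xi.
Proof.
move=> dF.
have cF a b : {within `[a, b], continuous F}.
  apply: continuous_subspaceT => r; apply: differentiable_continuous.
  by apply/derivable1_diffP; have [] := dF r.
have [k0|k0] := leP 0 k.
  have xk : x <= x + k by lra.
  have [c] := MVT_segment xk (fun t _ => dF t) (cF _ _).
  rewrite in_itv /= => /andP[c1 c2] e; exists c.
    by rewrite !ger0_norm; lra.
  by rewrite e; ring.
have xk : x + k <= x by lra.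
have [c] := MVT_segment xk (fun t _ => dF t) (cF _ _).
rewrite in_itv /= => /andP[c1 c2] e; exists c.
  by rewrite !ler0_norm; lra.
have -> : F (x + k) - F x = - (F x - F (x + k)) by ring.
by rewrite e; ring.
Qed.

(** Taylor bounds; the constants are not the optimal 1/2 and 1/6, which two
    nested applications of the mean value theorem do not give. *)
Lemma taylor1 F (F1 F2 : R -> R) x k C :
  (forall t : R, is_derive t 1 F (F1 t)) -> (forall t : R, is_derive t 1 F1 (F2 t)) ->
  (forall t : R, `|F2 t| <= C) ->
  `|F (x + k) - F x - k * F1 x| <= C * `|k| ^+ 2.
Proof.
move=> dF dF1 F2C.
have [xi xik ->] := mean_value x k dF.
have [ze _ e] := mean_value x (xi - x) dF1.
have -> : k * F1 xi - k * F1 x = k * ((xi - x) * F2 ze).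
  by rewrite -e [x + _]addrC subrK; ring.
rewrite !normrM (_ : C * `|k| ^+ 2 = `|k| * (`|k| * C)); last by ring.
by rewrite ler_wpM2l// ler_pM.
Qed.

Lemma taylor2 F (F1 F2 F3 : R -> R) x k C :
  (forall t : R, is_derive t 1 F (F1 t)) -> (forall t : R, is_derive t 1 F1 (F2 t)) ->
  (forall t : R, is_derive t 1 F2 (F3 t)) -> (forall t : R, `|F3 t| <= C) ->
  `|F (x + k) - F x - k * F1 x - k ^+ 2 / 2 * F2 x| <= C * `|k| ^+ 3.
Proof.
move=> dF dF1 dF2 F3C.
(* H subtracts the Taylor polynomial, so that taylor1 bounds its derivative. *)
pose H t := F t - (t - x) * F1 x - (t - x) ^+ 2 / 2 * F2 x.
have dH (t : R) : is_derive t 1 H (F1 t - F1 x - (t - x) * F2 x).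
  rewrite /H; apply: is_derive_eq.
  by rewrite /GRing.scale/= !mulr0; field.
have [xi xik] := mean_value x k dH.
have -> : H (x + k) - H x = F (x + k) - F x - k * F1 x - k ^+ 2 / 2 * F2 x.
  by rewrite /H; ring.
move=> ->.
have := taylor1 x (xi - x) dF1 dF2 F3C; rewrite [x + _]addrC subrK => T.
have C0 : 0 <= C by apply: le_trans (F3C 0); exact: normr_ge0.
rewrite normrM exprS mulrCA ler_wpM2l//; apply: le_trans T _.
by rewrite ler_wpM2l// ler_pXn2r ?nnegrE.
Qed.

End calculus.

Section gaussian.
Variable R : realType.
Implicit Types x y t : R.

Lemma ln_ge_1BV x : 0 < x -> 1 - x^-1 <= ln x.
Proof.
move=> x0; have xV0 : 0 < x^-1 by rewrite invr_gt0.
have : ln (1 + (x^-1 - 1)) <= x^-1 - 1 by apply: le_ln1Dx; lra.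
rewrite addrC subrK lnV ?posrE//; lra.
Qed.

Definition gauss_pdf x : R := normal_pdf 0 1 x.
Definition gauss_cdf x : R := fine (normal_prob (0 : R) 1 `]-oo, x]%classic).

Lemma gauss_cdfE x : normal_prob (0 : R) 1 `]-oo, x]%classic = (gauss_cdf x)%:E.
Proof. by rewrite /gauss_cdf fineK// fin_num_measure. Qed.

Lemma gauss_pdfE x :
  gauss_pdf x = normal_peak 1 * expR (- (x ^+ 2 / 2)).
Proof.
rewrite /gauss_pdf normal_pdfE ?oner_neq0// /normal_fun subr0 expr1n mulNr.
by rewrite -[1 *+ 2]/(2%:R).
Qed.

Lemma gauss_pdf_ge0 x : 0 <= gauss_pdf x.
Proof. exact: normal_pdf_ge0. Qed.

Lemma normal_peak1_le1 : normal_peak (1 : R) <= 1.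
Proof.
rewrite /normal_peak expr1n mul1r invf_le1.
  rewrite -[leLHS]sqrtr1 ler_sqrt; have := pi_ge2 R; rewrite -mulr_natr; lra.
by rewrite sqrtr_gt0 pmulrn_lgt0// pi_gt0.
Qed.

(** exp(x^2/2) is the square of exp(x^2/4) >= 1 + x^2/4; this beats every
    polynomial met in the first three derivatives of the distribution
    function. *)
Lemma gauss_pdf_decay x : gauss_pdf x * (1 + x ^+ 2 / 4) ^+ 2 <= 1.
Proof.
have e : 1 + x ^+ 2 / 4 <= expR (x ^+ 2 / 4) by exact: expR_ge1Dx.
have sq0 : 0 <= x ^+ 2 / 4 by rewrite mulr_ge0// sqr_ge0.
rewrite gauss_pdfE -mulrA mulr_ile1 ?normal_peak_ge0 ?normal_peak1_le1//.
  by rewrite mulr_ge0 ?expR_ge0 ?sqr_ge0.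
rewrite expRN mulrC ler_pdivrMr ?expR_gt0// mul1r.
have -> : x ^+ 2 / 2 = x ^+ 2 / 4 + x ^+ 2 / 4 by field.
by rewrite expRD -expr2 ler_pXn2r ?nnegrE ?expR_ge0//; lra.
Qed.

Lemma is_derive_gauss_cdf x : is_derive x 1 gauss_cdf (gauss_pdf x).
Proof.
have int y : lebesgue_measure.-integrable `]-oo, y] (EFin \o @normal_pdf R 0 1).
  apply: (integrableS measurableT) => //; exact: integrable_normal_pdf.
have [] := @continuous_FTC1 R (normal_pdf 0 1) -oo%O x (x + 1) _ (int _) _ _.
- lra.
- by rewrite ltNyr.
- by apply: continuous_normal_pdf; rewrite oner_neq0.
move=> dF e; rewrite derive1E in e; exact: DeriveDef.
Qed.

Lemma is_derive_gauss_pdf x : is_derive x 1 gauss_pdf (- x * gauss_pdf x).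
Proof.
have -> : gauss_pdf = (fun x => normal_peak 1 * expR (- (x ^+ 2 / 2))).
  by apply/funext => y; exact: gauss_pdfE.
apply: is_derive_eq.
by rewrite /GRing.scale/= !mulr0; field.
Qed.

Lemma gauss_pdf_decayE x :
  gauss_pdf x * (1 + x ^+ 2 / 2 + (x ^+ 2) ^+ 2 / 16) <= 1.
Proof.
apply: le_trans (gauss_pdf_decay x).
by rewrite le_eqVlt; apply/orP; left; apply/eqP; field.
Qed.

Lemma norm_mul_gauss_pdf x b c : 0 <= c ->
  `|b| <= c * (1 + x ^+ 2 / 2 + (x ^+ 2) ^+ 2 / 16) -> `|b * gauss_pdf x| <= c.
Proof.
move=> c0 bc; rewrite normrM (ger0_norm (gauss_pdf_ge0 x)).
have := gauss_pdf_decayE x; have := gauss_pdf_ge0 x.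
set g := gauss_pdf x => g0; set e := (X in c * X) in bc * => ge1.
apply: (@le_trans _ _ (c * e * g)); first by rewrite ler_wpM2r.
by rewrite -mulrA ler_piMr// mulrC.
Qed.

Lemma norm_gauss_pdf1 x : `|- x * gauss_pdf x| <= 1.
Proof.
apply: norm_mul_gauss_pdf => //; rewrite normrN mul1r.
rewrite -(real_normK (num_real x)); have := normr_ge0 x; nra.
Qed.

Lemma norm_gauss_pdf2 x : `|(x ^+ 2 - 1) * gauss_pdf x| <= 2.
Proof.
apply: norm_mul_gauss_pdf => //; rewrite ler_norml.
have := sqr_ge0 x; set s := x ^+ 2; nra.
Qed.

Lemma norm_gauss_pdf3 x : `|- x * ((x ^+ 2 - 1) * gauss_pdf x)| <= 8.
Proof.
rewrite mulrA; apply: norm_mul_gauss_pdf => //; rewrite normrM normrN.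
have s1 : `|x ^+ 2 - 1| <= x ^+ 2 + 1.
  by rewrite ler_norml; have := sqr_ge0 x; set s := x ^+ 2; lra.
apply: le_trans (ler_wpM2l (normr_ge0 x) s1) _.
rewrite -(real_normK (num_real x)); have := normr_ge0 x; set z := `|x|.
have := sqr_ge0 (z - 1); nra.
Qed.

Lemma is_derive_gauss_pdf1 x :
  is_derive x 1 (fun t : R => - t * gauss_pdf t) ((x ^+ 2 - 1) * gauss_pdf x).
Proof.
have dg := is_derive_gauss_pdf x.
apply: is_derive_eq.
by rewrite /GRing.scale/=; ring.
Qed.

(** Moving y by -eta (1 - p) with probability p and by eta p otherwise is a
    centred move of variance eta^2 p (1 - p): the first order term of the Taylor
    expansion cancels, and - y * gauss_pdf y is the second derivative. *)
Lemma gauss_bernoulli_step y eta p : 0 <= eta -> 0 <= p <= 1 ->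
  `|p * gauss_cdf (y - eta * (1 - p)) + (1 - p) * gauss_cdf (y + eta * p)
    - gauss_cdf y - eta ^+ 2 * (p * (1 - p)) / 2 * (- y * gauss_pdf y)|
  <= 2 * eta ^+ 3 * p.
Proof.
move=> e0 /andP[p0 p1].
have T k := taylor2 y k is_derive_gauss_cdf is_derive_gauss_pdf
                    is_derive_gauss_pdf1 norm_gauss_pdf2.
have := T (- (eta * (1 - p))); have := T (eta * p).
set A1 := (X in `|X| <= _); set A2 := (X in _ -> `|X| <= _ -> _).
have p1' : 0 <= 1 - p by lra.
rewrite normrN (@ger0_norm _ (eta * p)) ?mulr_ge0//.
rewrite (@ger0_norm _ (eta * (1 - p))) ?mulr_ge0// => T1 T2.
rewrite (_ : _ - _ = p * A2 + (1 - p) * A1); last by rewrite /A1 /A2; field.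
apply: le_trans (ler_normD _ _) _.
rewrite !normrM (ger0_norm p0) (ger0_norm p1').
apply: le_trans (lerD (ler_wpM2l p0 T2) (ler_wpM2l p1' T1)) _.
rewrite -subr_ge0.
rewrite (_ : _ - _ =
  2 * eta ^+ 3 * p * (1 - (1 - p) * ((1 - p) ^+ 2 + p ^+ 2))); last by ring.
rewrite mulr_ge0 ?mulr_ge0 ?exprn_ge0//.
nra.
Qed.

(** The time derivative of the smoothed half-line.  With 1 + w = exp(2u) the
    scaled point is y exp(-u), so this is a first order expansion in u at 0,
    followed by the replacement of u by w / 2, which costs O(w^2). *)
Lemma gauss_scale_step y w : 0 <= w ->
  `|gauss_cdf (y / Num.sqrt (1 + w)) - gauss_cdf y - w / 2 * (- y * gauss_pdf y)|
  <= 3 * w ^+ 2.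
Proof.
move=> w0; pose u := ln (1 + w) / 2.
have u1 : u <= w / 2 by rewrite ler_wpM2r// le_ln1Dx//; lra.
have u0 : 0 <= u by rewrite divr_ge0// ln_ge0//; lra.
have u2 : w / 2 - w ^+ 2 / 2 <= u.
  have w10 : 0 < 1 + w by lra.
  have := ln_ge_1BV w10.
  have : w - w ^+ 2 <= 1 - (1 + w)^-1.
    rewrite -subr_ge0 (_ : _ - _ = w ^+ 3 / (1 + w)).
      by rewrite divr_ge0 ?exprn_ge0// ltW.
    by field; rewrite gt_eqF.
  rewrite /u; lra.
have -> : y / Num.sqrt (1 + w) = y * expR (- u).
  have -> : 1 + w = expR u ^+ 2.
    rewrite expr2 -expRD (_ : u + u = ln (1 + w)); last by rewrite /u; field.
    by rewrite lnK// posrE; lra.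
  by rewrite sqrtr_sqr ger0_norm ?expR_ge0// expRN.
(* Expansion in u of the composition with z, whose derivative is - z. *)
pose z t := y * expR (- t).
pose F1 t := - z t * gauss_pdf (z t).
have dz (t : R) : is_derive t 1 z (- z t).
  by rewrite /z; apply: is_derive_eq; rewrite /GRing.scale/=; ring.
have dF (t : R) : is_derive t 1 (gauss_cdf \o z) (F1 t).
  have d1 := is_derive_gauss_cdf (z t); have d2 := dz t.
  by apply: is_derive_eq; rewrite /F1; ring.
have dF1 (t : R) : is_derive t 1 F1 (- z t * ((z t ^+ 2 - 1) * gauss_pdf (z t))).
  have d1 := is_derive_gauss_pdf1 (z t); have d2 := dz t.
  rewrite (_ : F1 = (fun t : R => - t * gauss_pdf t) \o z)//.
  by apply: is_derive_eq; rewrite mulrC.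
have := taylor1 0 u dF dF1 (fun t => norm_gauss_pdf3 (z t)).
rewrite add0r /F1 /= /z oppr0 expR0 mulr1 (ger0_norm u0) => T.
set A := (X in `|X| <= _) in T.
rewrite (_ : _ - _ = A + (u - w / 2) * (- y * gauss_pdf y)); last by rewrite /A; ring.
apply: le_trans (ler_normD _ _) _.
have : `|(u - w / 2) * (- y * gauss_pdf y)| <= w ^+ 2 / 2 * 1.
  rewrite normrM ler_pM// ?norm_gauss_pdf1// ler0_norm; lra.
have : u ^+ 2 <= (w / 2) ^+ 2 by rewrite ler_pXn2r ?nnegrE//; lra.
have -> : (w / 2) ^+ 2 = w ^+ 2 / 4 by field.
move: T; set B := `|_ * _|; set v := u ^+ 2; lra.
Qed.

(** The half-line `]-oo, a] smoothed by Gaussian noise of variance r.  As a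
    function of (r, x) it solves the heat equation d/dr = (1/2) d^2/dx^2. *)
Definition gauss_smooth a r x := gauss_cdf ((a - x) / Num.sqrt r).

(** One exchange: a centred Bernoulli step of size h costs little more than
    the extra noise variance h^2 p.  The variance of the step is in fact
    h^2 p (1 - p); the difference is the term in eta^2 p^2. *)
Lemma gauss_smooth_step a r h p x eta : 0 < r -> 0 <= h -> 0 <= p <= 1 ->
  eta = h / Num.sqrt r ->
  `|p * gauss_smooth a r (x + h * (1 - p)) + (1 - p) * gauss_smooth a r (x - h * p)
    - gauss_smooth a (r + h ^+ 2 * p) x|
  <= 2 * eta ^+ 3 * p + eta ^+ 2 * p ^+ 2 + 3 * eta ^+ 4 * p ^+ 2.
Proof.
move=> r0 h0 p01 etaE; have /andP[p0 p1] := p01.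
have sr0 : 0 < Num.sqrt r by rewrite sqrtr_gt0.
have srn0 : Num.sqrt r != 0 by rewrite gt_eqF.
have eta0 : 0 <= eta by rewrite etaE divr_ge0// ltW.
pose y := (a - x) / Num.sqrt r.
have w0 : 0 <= eta ^+ 2 * p by rewrite mulr_ge0 ?exprn_ge0.
have := gauss_bernoulli_step y eta0 p01.
have := gauss_scale_step y w0.
rewrite /gauss_smooth.
have -> : (a - (x + h * (1 - p))) / Num.sqrt r = y - eta * (1 - p).
  by rewrite /y etaE; field.
have -> : (a - (x - h * p)) / Num.sqrt r = y + eta * p.
  by rewrite /y etaE; field.
have -> : (a - x) / Num.sqrt (r + h ^+ 2 * p) = y / Num.sqrt (1 + eta ^+ 2 * p).
  have -> : r + h ^+ 2 * p = r * (1 + eta ^+ 2 * p).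
    by rewrite etaE expr_div_n sqr_sqrtr ?ltW//; field; rewrite gt_eqF.
  rewrite sqrtrM ?ltW// /y; field; rewrite srn0 gt_eqF// sqrtr_gt0; lra.
set A1 := (X in `|X| <= _); set A2 := (X in _ -> `|X| <= _ -> _) => T1 T2.
rewrite (_ : _ - _ = A2 - A1 + - (eta ^+ 2 * p ^+ 2 / 2) * (- y * gauss_pdf y)); last first.
  by rewrite /A1 /A2; field.
apply: le_trans (ler_normD _ _) _.
have : `|- (eta ^+ 2 * p ^+ 2 / 2) * (- y * gauss_pdf y)| <= eta ^+ 2 * p ^+ 2 / 2 * 1.
  rewrite normrM ler_pM// ?norm_gauss_pdf1// normrN ger0_norm//.
  by rewrite !mulr_ge0 ?exprn_ge0.
have := ler_normB A2 A1.
have : 0 <= eta ^+ 2 * p ^+ 2 by rewrite mulr_ge0 ?exprn_ge0.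
move: T1; rewrite exprMn -exprM; lra.
Qed.

End gaussian.

(** * The Lindeberg exchange for independent Bernoulli variables *)

Section lindeberg.
Variable R : realType.
Implicit Types (a r h x p : R) (ps : seq R).

Definition bernoulli_pmf p (b : bool) : R := if b then p else 1 - p.

Lemma all_pmf_bernoulli ps : all (fun p => 0 <= p <= 1) ps ->
  all_pmf (map bernoulli_pmf ps).
Proof.
move=> /allP ps01 k; rewrite size_map => kps.
rewrite (nth_map 0)//; have /andP[p0 p1] := ps01 _ (mem_nth 0 kps).
split=> [[]|]; rewrite /bernoulli_pmf ?subr_ge0//.
by rewrite big_bool /= addrC subrK.
Qed.

Definition lindeberg_err (e : R) ps : R :=
  2 * e ^+ 3 * (\sum_(p <- ps) p) + (e ^+ 2 + 3 * e ^+ 4) * \sum_(p <- ps) p ^+ 2.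

(** The telescoped exchanges, by induction on the list of parameters: the
    noise level is never below r, so h / sqrt r bounds every step size. *)
Lemma bernoulli_lindeberg a r h ps x : 0 < r -> 0 <= h -> all (fun p => 0 <= p <= 1) ps ->
  `|prod_mean (map bernoulli_pmf ps)
      (fun s => gauss_smooth a r (x + h * ((count id s)%:R - \sum_(p <- ps) p)))
    - gauss_smooth a (r + h ^+ 2 * \sum_(p <- ps) p) x|
  <= lindeberg_err (h / Num.sqrt r) ps.
Proof.
move=> r0 h0; rewrite /lindeberg_err.
elim: ps x => [x _|p ps IH x /= /andP[p01 ps01]].
  by rewrite /= !big_nil !mulr0 subr0 mulr0 !addr0 subrr normr0.
set e := h / Num.sqrt r; rewrite big_bool !big_cons /=.
have e0 : 0 <= e by rewrite divr_ge0// sqrtr_ge0.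
set S := \sum_(p <- ps) p in IH *; set S2 := \sum_(p <- ps) p ^+ 2 in IH *.
have S0 : 0 <= S.
  by rewrite /S big_seq sumr_ge0// => q /(allP ps01)/andP[].
have /andP[p0 p1] := p01; have p1' : 0 <= 1 - p by lra.
rewrite (eq_prod_mean _ (G := fun s =>
  gauss_smooth a r (x + h * (1 - p) + h * ((count id s)%:R - S)))); last first.
  by move=> s; rewrite natrD; congr (gauss_smooth _ _ _); ring.
rewrite [X in _ + (1 - p) * X](eq_prod_mean _ (G := fun s =>
  gauss_smooth a r (x - h * p + h * ((count id s)%:R - S)))); last first.
  by move=> s; rewrite add0n; congr (gauss_smooth _ _ _); ring.
have := IH (x + h * (1 - p)) ps01; have := IH (x - h * p) ps01.
pose E := 2 * e ^+ 3 * S + (e ^+ 2 + 3 * e ^+ 4) * S2.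
rewrite -/e -/E.
set A1 := (X in `|X| <= _); set A2 := (X in _ -> `|X| <= _ -> _) => H1 H2.
set r' := r + h ^+ 2 * S.
have r'0 : 0 < r' by rewrite ltr_pwDl// mulr_ge0// exprn_ge0.
pose e' := h / Num.sqrt r'.
have e'0 : 0 <= e' by rewrite divr_ge0// sqrtr_ge0.
have ee' : e' <= e.
  apply: ler_wpM2l => //; rewrite lef_pV2 ?posrE ?sqrtr_gt0//.
  by rewrite ler_sqrt ?(ltW r'0)// /r' lerDl mulr_ge0// exprn_ge0.
have := gauss_smooth_step a x r'0 h0 p01 (erefl e').
have -> : r' + h ^+ 2 * p = r + h ^+ 2 * (p + S) by rewrite /r'; ring.
set A3 := (X in `|X| <= _) => H3.
rewrite (_ : _ - _ = p * A2 + (1 - p) * A1 + A3); last first.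
  by rewrite /A1 /A2 /A3 /bernoulli_pmf; ring.
have : `|p * A2 + (1 - p) * A1 + A3| <= p * `|A2| + (1 - p) * `|A1| + `|A3|.
  apply: le_trans (ler_normD _ _) _; rewrite lerD2r.
  have := ler_normD (p * A2) ((1 - p) * A1).
  by rewrite normrM (ger0_norm p0) normrM (ger0_norm p1').
have : p * `|A2| + (1 - p) * `|A1| <= E.
  have -> : E = p * E + (1 - p) * E by ring.
  by rewrite lerD// ler_wpM2l.
have : e' ^+ 3 * p <= e ^+ 3 * p by rewrite ler_wpM2r// lerXn2r ?nnegrE.
have : e' ^+ 2 * p ^+ 2 <= e ^+ 2 * p ^+ 2.
  by rewrite ler_wpM2r ?exprn_ge0// lerXn2r ?nnegrE.
have : e' ^+ 4 * p ^+ 2 <= e ^+ 4 * p ^+ 2.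
  by rewrite ler_wpM2r ?exprn_ge0// lerXn2r ?nnegrE.
rewrite /E; lra.
Qed.

End lindeberg.

(** * The Gaussian limit of normalised Bernoulli sums *)

Section gauss_cdf_limits.
Variable R : realType.
Implicit Types x y d : R.

Lemma gauss_cdf_ge0 x : 0 <= gauss_cdf x.
Proof. by rewrite /gauss_cdf fine_ge0. Qed.

Lemma gauss_cdf_le1 x : gauss_cdf x <= 1.
Proof. by rewrite -lee_fin -gauss_cdfE probability_le1. Qed.

Lemma gauss_cdf_ndecr x y : x <= y -> gauss_cdf x <= gauss_cdf y.
Proof.
move=> xy; rewrite -lee_fin -!gauss_cdfE le_measure ?inE//.
exact: subitvPr.
Qed.

Let idTR : measurableTypeR R -> R := idfun.

#[local] HB.instance Definition _ :=
  @isMeasurableFun.Build _ _ _ _ idTR (@measurable_id _ _ setT).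

Let cdf_idTR :
  cdf (idTR : {RV (normal_prob (0 : R) 1) >-> R}) = EFin \o @gauss_cdf R.
Proof. by apply/funext => x; rewrite /= -gauss_cdfE. Qed.

Lemma cvg_gauss_cdf_pinfty : gauss_cdf x @[x --> +oo] --> (1 : R).
Proof.
have := cvg_cdfy1 (idTR : {RV (normal_prob (0 : R) 1) >-> R}).
by rewrite cdf_idTR => /fine_cvg.
Qed.

Lemma cvg_gauss_cdf_ninfty : gauss_cdf x @[x --> -oo] --> (0 : R).
Proof.
have := cvg_cdfNy0 (idTR : {RV (normal_prob (0 : R) 1) >-> R}).
by rewrite cdf_idTR => /fine_cvg.
Qed.

Lemma continuous_gauss_cdf : continuous (@gauss_cdf R).
Proof.
move=> x; apply: differentiable_continuous.
by apply/derivable1_diffP; have [] := is_derive_gauss_cdf x.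
Qed.

(** The limiting bounds on the distribution function at x when the half-line
    is shifted by d and smoothed at noise level d^4: the shift is d^-1 standard
    deviations of the noise, so both the shift and the leakage across it vanish
    with d. *)
Definition clt_upper x d : R :=
  gauss_cdf ((x + d) / Num.sqrt (d ^+ 4 + 1)) + (1 - gauss_cdf d^-1).

Definition clt_lower x d : R :=
  gauss_cdf ((x - d) / Num.sqrt (d ^+ 4 + 1)) - gauss_cdf (- d^-1).

Lemma cvg_rescale x (c : R) :
  gauss_cdf ((x + c * d) / Num.sqrt (d ^+ 4 + 1)) @[d --> 0^'+] --> gauss_cdf x.
Proof.
apply: cvg_at_right_filter; apply: continuous_cvg; first exact: continuous_gauss_cdf.
have x0 : (x + c * 0) / Num.sqrt (0 ^+ 4 + 1) = x.
  by rewrite mulr0 addr0 expr0n add0r sqrtr1 divr1.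
rewrite -[X in _ --> X]x0.
apply: cvgM.
  by apply: cvgD; [exact: cvg_cst|apply: cvgM; [exact: cvg_cst|exact: cvg_id]].
apply: cvgV; first by rewrite expr0n add0r sqrtr1 oner_neq0.
apply: continuous_cvg; first exact: sqrt_continuous.
by apply: cvgD; [exact: exprn_continuous|exact: cvg_cst].
Qed.

Lemma cvg_inv_right : d^-1 @[d --> (0 : R)^'+] --> +oo.
Proof.
apply/cvgrVy; first exact: nbhs_right_gt.
exact: cvg_at_right_filter cvg_id.
Qed.

Lemma cvg_clt_upper x : clt_upper x d @[d --> 0^'+] --> gauss_cdf x.
Proof.
rewrite -[X in _ --> X]addr0 -[X in _ --> _ + X](subrr (1 : R)).
apply: cvgD.
  by have := @cvg_rescale x 1; under eq_fun do rewrite mul1r.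
apply: cvgB; first exact: cvg_cst.
exact: (cvg_comp _ _ cvg_inv_right cvg_gauss_cdf_pinfty).
Qed.

Lemma cvg_clt_lower x : clt_lower x d @[d --> 0^'+] --> gauss_cdf x.
Proof.
rewrite -[X in _ --> X]subr0.
apply: cvgB.
  by have := @cvg_rescale x (-1); under eq_fun do rewrite mulN1r.
apply: (cvg_comp _ _ _ cvg_gauss_cdf_ninfty).
by apply/cvgNrNy; exact: cvg_inv_right.
Qed.

(** To the left of x the smoothed half-line ending at x + d misses 1 by at most
    the leakage 1 - gauss_cdf d^-1; the lower bound is symmetric. *)
Lemma gauss_smooth_upper x d y : 0 < d ->
  (y <= x)%R%:R <= gauss_smooth (x + d) (d ^+ 4) y + (1 - gauss_cdf d^-1).
Proof.
move=> d0; have := gauss_cdf_le1 d^-1; rewrite /gauss_smooth.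
case: (leP y x) => /= xy; last first.
  by have := gauss_cdf_ge0 ((x + d - y) / Num.sqrt (d ^+ 4)); lra.
suff : gauss_cdf d^-1 <= gauss_cdf ((x + d - y) / Num.sqrt (d ^+ 4)) by lra.
apply: gauss_cdf_ndecr.
have -> : d ^+ 4 = (d ^+ 2) ^+ 2 by rewrite -exprM.
rewrite sqrtr_sqr ger0_norm ?sqr_ge0// ler_pdivlMr ?exprn_gt0//.
rewrite expr2 mulKf ?gt_eqF//; lra.
Qed.

Lemma gauss_smooth_lower x d y : 0 < d ->
  gauss_smooth (x - d) (d ^+ 4) y - gauss_cdf (- d^-1) <= (y <= x)%R%:R.
Proof.
move=> d0; have := gauss_cdf_ge0 (- d^-1); rewrite /gauss_smooth.
case: (leP y x) => /= xy.
  by have := gauss_cdf_le1 ((x - d - y) / Num.sqrt (d ^+ 4)); lra.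
suff : gauss_cdf ((x - d - y) / Num.sqrt (d ^+ 4)) <= gauss_cdf (- d^-1) by lra.
apply: gauss_cdf_ndecr.
have -> : d ^+ 4 = (d ^+ 2) ^+ 2 by rewrite -exprM.
rewrite sqrtr_sqr ger0_norm ?sqr_ge0// ler_pdivrMr ?exprn_gt0//.
rewrite expr2 mulNr mulKf ?gt_eqF//; lra.
Qed.

End gauss_cdf_limits.

Section bernoulli_clt.
Variable R : realType.
Implicit Types (x d : R) (ps : seq R).

(** The distribution function of the normalised number of successes, with
    the normalisation by the mean instead of the variance. *)
Definition std_count_cdf ps x : R :=
  prod_mean (map (@bernoulli_pmf R) ps)
    (fun s => (((count id s)%:R - \sum_(p <- ps) p) / Num.sqrt (\sum_(p <- ps) p)
               <= x)%R%:R).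

Lemma std_count_cdf_bounds ps x d : all (fun p => 0 <= p <= 1) ps ->
  0 < \sum_(p <- ps) p -> 0 < d ->
  let err := lindeberg_err ((d ^+ 2 * Num.sqrt (\sum_(p <- ps) p))^-1) ps in
  clt_lower x d - err <= std_count_cdf ps x /\
  std_count_cdf ps x <= clt_upper x d + err.
Proof.
move=> ps01; rewrite /std_count_cdf; set M := \sum_(p <- ps) p => M0 d0.
set err := lindeberg_err _ _.
have sM0 : 0 < Num.sqrt M by rewrite sqrtr_gt0.
have d40 : 0 < d ^+ 4 by rewrite exprn_gt0.
have pq := all_pmf_bernoulli ps01.
have h0 : 0 <= (Num.sqrt M)^-1 by rewrite invr_ge0 ltW.
have L a := bernoulli_lindeberg a 0 d40 h0 ps01.
have hM : (Num.sqrt M)^-1 ^+ 2 * M = 1.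
  by rewrite exprVn sqr_sqrtr ?(ltW M0)// mulVf// gt_eqF.
have he : (Num.sqrt M)^-1 / Num.sqrt (d ^+ 4) = (d ^+ 2 * Num.sqrt M)^-1.
  have -> : d ^+ 4 = (d ^+ 2) ^+ 2 by rewrite -exprM.
  rewrite sqrtr_sqr (ger0_norm (sqr_ge0 d)) [RHS]invfM; exact: mulrC.
split.
- have := L (x - d); rewrite -/M hM he -/err ler_norml => /andP[+ _].
  rewrite /clt_lower /gauss_smooth subr0 => H.
  set A := prod_mean _ _ in H.
  apply: (@le_trans _ _ (A - gauss_cdf (- d^-1))); first lra.
  rewrite -(prod_mean_cst (- gauss_cdf (- d^-1)) pq) -prod_meanD.
  apply: le_prod_mean => // s; rewrite add0r [_^-1 * (_ - M)]mulrC.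
  exact: (gauss_smooth_lower x _ d0).
- have := L (x + d); rewrite -/M hM he -/err ler_norml => /andP[_ +].
  rewrite /clt_upper /gauss_smooth subr0 => H.
  set A := prod_mean _ _ in H.
  apply: (@le_trans _ _ (A + (1 - gauss_cdf d^-1))); last lra.
  rewrite -(prod_mean_cst (1 - gauss_cdf d^-1) pq) -prod_meanD.
  apply: le_prod_mean => // s; rewrite add0r [_^-1 * (_ - M)]mulrC.
  exact: (gauss_smooth_upper x _ d0).
Qed.

End bernoulli_clt.

Section ratio_limits.
Variable R : realType.
Implicit Types (a g m B p : nat -> R) (d : R).

(** The form in which all negligible terms arise: for every slope d > 0, B is
    at most d m up to a constant. *)
Lemma cvg_ratio0 B m :
  (forall d, 0 < d -> exists N : nat, forall n, `|B n| <= N%:R + d * m n) ->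
  m n @[n --> \oo] --> +oo -> B n / m n @[n --> \oo] --> 0.
Proof.
move=> Bm moo; apply/cvgr0Pnorm_le => e e0.
have e20 : 0 < e / 2 by rewrite divr_gt0.
have [N BN] := Bm _ e20.
have mgt A : \forall n \near \oo, A < m n by move/cvgryPgt: moo; exact.
near=> n.
have m0 : 0 < m n by near: n; exact: mgt.
have mN : N%:R / (e / 2) <= m n by apply: ltW; near: n; exact: mgt.
rewrite normrM normfV (gtr0_norm m0) ler_pdivrMr//; apply: le_trans (BN n) _.
move: mN; rewrite ler_pdivrMr//; lra.
Unshelve. all: by end_near. Qed.

(** A weight g that tends to 0 makes a sum negligible: the first N terms are
    bounded by 1 and the others by d a t. *)
Lemma sum_mul_small a g N d K : (forall t, 0 <= a t <= 1) ->
  (forall t, 0 <= g t <= 1) -> (forall t, (N <= t)%N -> g t <= d) -> 0 <= d ->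
  \sum_(0 <= t < K) a t * g t <= N%:R + d * \sum_(0 <= t < K) a t.
Proof.
move=> a01 g01 gd d0.
have le t : a t * g t <= (t < N)%:R + d * a t.
  have /andP[a0 a1] := a01 t; have /andP[g0 g1] := g01 t.
  have [tN|Nt] := ltnP t N; last first.
    by rewrite add0r mulrC ler_wpM2r// gd.
  by rewrite -[leLHS]addr0 lerD ?mulr_ge0// mulr_ile1.
apply: le_trans (ler_sum _ (fun t _ => le t)) _.
rewrite big_split /= -mulr_sumr lerD2r -natr_sum ler_nat.
apply: (@leq_trans (\sum_(0 <= t < maxn K N) (t < N))%N).
  by rewrite [leqRHS](big_cat_nat (n := K))//= ?leq_maxl// leq_addr.
rewrite (big_cat_nat (n := N))//= ?leq_maxr// big_nat.
rewrite (eq_bigr (fun=> 1%N)) => [|t /andP[_ ->]//].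
have -> : (\sum_(N <= t < maxn K N) (t < N) = 0)%N.
  by rewrite big_nat big1// => t /andP[Nt _]; rewrite ltnNge Nt.
by rewrite addn0 -big_nat sum_nat_const_nat muln1 subn0.
Qed.

Variable p : nat -> R.
Hypothesis p01 : forall t, 0 <= p t <= 1.
Let m n := \sum_(1 <= t < n.+1) p t.
Hypothesis p0 : p n @[n --> \oo] --> 0.
Hypothesis moo : m n @[n --> \oo] --> +oo.

(** This is where p t -> 0 is used: it makes the sum of the variances
    p t (1 - p t) equivalent to m. *)
Lemma cvg_sum_sqr_ratio0 :
  (\sum_(1 <= t < n.+1) p t ^+ 2) / m n @[n --> \oo] --> 0.
Proof.
apply: cvg_ratio0 => // d d0.
have [N _ Nd] : \forall n \near \oo, p n <= d.
  move/cvgr0Pnorm_le : p0 => /(_ d d0); apply: filterS => n.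
  exact: le_trans (ler_norm _).
exists N => n; rewrite ger0_norm; last by apply: sumr_ge0 => t _; exact: sqr_ge0.
rewrite /m !big_add1 /=.
apply: (sum_mul_small (a := fun t => p t.+1) (g := fun t => p t.+1)) => //.
- by move=> t Nt; apply: Nd => /=; exact: leqW.
- exact: ltW.
Qed.

Let ps n := [seq p t | t <- index_iota 1 n.+1].

Lemma bernoulli_clt x : std_count_cdf (ps n) x @[n --> \oo] --> gauss_cdf x.
Proof.
have mgt A : \forall n \near \oo, A < m n by move/cvgryPgt: moo; exact.
have ps01 n : all (fun q => 0 <= q <= 1) (ps n).
  by apply/allP => q /mapP[t _ ->].
have sumE n : \sum_(q <- ps n) q = m n by rewrite big_map.
have sum2E n : \sum_(q <- ps n) q ^+ 2 = \sum_(1 <= t < n.+1) p t ^+ 2.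
  by rewrite big_map.
have sqrtoo : (Num.sqrt (m n))^-1 @[n --> \oo] --> 0.
  apply/gtr0_cvgV0.
    near=> n; rewrite sqrtr_gt0; near: n; exact: mgt.
  apply/cvgryPge => A; near=> n.
  apply: (@le_trans _ _ `|A|); first exact: ler_norm.
  rewrite -sqrtr_sqr ler_wsqrtr//; apply: ltW; near: n; exact: mgt.
have err0 d : 0 < d -> lindeberg_err ((d ^+ 2 * Num.sqrt (m n))^-1) (ps n)
    @[n --> \oo] --> 0.
  move=> d0; pose c := (d ^+ 2)^-1.
  pose rho n := (\sum_(1 <= t < n.+1) p t ^+ 2) / m n.
  pose s n := (Num.sqrt (m n))^-1.
  have : 2 * c ^+ 3 * s n + (c ^+ 2 * rho n + 3 * c ^+ 4 * (rho n * (s n * s n)))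
      @[n --> \oo] --> 2 * c ^+ 3 * 0 + (c ^+ 2 * 0 + 3 * c ^+ 4 * (0 * (0 * 0))).
    have rho0 := cvg_sum_sqr_ratio0.
    have cc (k : R) : (fun=> k) @ \oo --> k by exact: cvg_cst.
    apply: cvgD; first exact: cvgM (cc _) sqrtoo.
    apply: cvgD; first exact: cvgM (cc _) rho0.
    exact: cvgM (cc _) (cvgM rho0 (cvgM sqrtoo sqrtoo)).
  rewrite !mulr0 !addr0; apply: cvg_trans; apply: near_eq_cvg.
  near=> n.
  have m0 : 0 < m n by near: n; exact: mgt.
  rewrite /lindeberg_err sumE sum2E invfM -/c -/(s n) /rho.
  have -> : m n = (s n)^-1 ^+ 2 by rewrite /s invrK sqr_sqrtr// ltW.
  have sn0 : s n != 0 by rewrite invr_neq0// gt_eqF// sqrtr_gt0.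
  by field.
apply/cvgrPdist_le => e e0.
have e20 : 0 < e / 2 by rewrite divr_gt0.
near (0 : R)^'+ => d.
have d0 : 0 < d by near: d; exact: nbhs_right_gt.
have up : `|gauss_cdf x - clt_upper x d| <= e / 2.
  near: d; move/cvgrPdist_le : (@cvg_clt_upper R x); exact.
have lo : `|gauss_cdf x - clt_lower x d| <= e / 2.
  near: d; move/cvgrPdist_le : (@cvg_clt_lower R x); exact.
near=> n.
have m0 : 0 < \sum_(q <- ps n) q by rewrite sumE; near: n; exact: mgt.
have : `|lindeberg_err ((d ^+ 2 * Num.sqrt (m n))^-1) (ps n)| <= e / 2.
  by near: n; move/cvgr0Pnorm_le : (err0 _ d0); apply.
have := std_count_cdf_bounds x (ps01 n) m0 d0; rewrite sumE.
set E := lindeberg_err _ _ => + +.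
move: up lo; rewrite !ler_norml => /andP[? ?] /andP[? ?] [? ?] /andP[? ?].
apply/andP; split; lra.
Unshelve. all: by end_near. Qed.

End ratio_limits.

(** * Means of bounded variables, and reduction to finite sums *)

Section bounded_mean.
Context d (T : measurableType d) (R : realType) (P : probability T R).
Implicit Types X Y : T -> R.

Definition mean X : R := fine 'E_P[X]%E.

Definition bounded_rv X : Prop :=
  measurable_fun setT X /\ exists M : R, forall w, `|X w| <= M.

Lemma bounded_rv_Lfun X : bounded_rv X -> X \in Lfun P 1%E.
Proof.
move=> [mX [M XM]]; apply/Lfun1_integrable.
apply: measurable_bounded_integrable => //.
  exact: le_lt_trans (probability_le1 _ measurableT) (ltry 1).
exists M; split; first exact: num_real.
by move=> N MN w _; exact: le_trans (XM w) (ltW MN).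
Qed.

Lemma meanE X : bounded_rv X -> 'E_P[X]%E = (mean X)%:E.
Proof. by move=> bX; rewrite fineK// expectation_fin_num// bounded_rv_Lfun. Qed.

Lemma meanB X Y : bounded_rv X -> bounded_rv Y -> mean (X \- Y) = mean X - mean Y.
Proof.
move=> bX bY; rewrite {1}/mean expectationB ?bounded_rv_Lfun//.
by rewrite !meanE.
Qed.

Lemma bounded_rvB X Y : bounded_rv X -> bounded_rv Y -> bounded_rv (X \- Y).
Proof.
move=> [mX [M XM]] [mY [N YN]]; split; first exact: measurable_funB.
by exists (M + N) => w; apply: le_trans (ler_normB _ _) _; rewrite lerD.
Qed.

Lemma mean_ge0 X : (forall w, 0 <= X w) -> 0 <= mean X.
Proof. by move=> X0; rewrite fine_ge0// expectation_ge0. Qed.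

Lemma le_mean X Y : bounded_rv X -> bounded_rv Y ->
  (forall w, X w <= Y w) -> mean X <= mean Y.
Proof.
move=> bX bY XY; rewrite -subr_ge0 -meanB// mean_ge0// => w.
by rewrite subr_ge0.
Qed.

Lemma bounded_rv_indic (A : set T) : measurable A -> bounded_rv \1_A.
Proof.
move=> mA; split; first exact: measurable_indic.
by exists 1 => w; rewrite indicE; case: (_ \in _); rewrite ?normr1 ?normr0.
Qed.

Lemma mean_indic (A : set T) : measurable A -> mean \1_A = fine (P A).
Proof. by move=> mA; rewrite /mean expectation_indic. Qed.

End bounded_mean.

Section path_law.
Context d (T : measurableType d) (R : realType) (P : probability T R).
Variable Z : nat -> {RV P >-> nat}.
Hypothesis Z_indep : mutually_independent P Z.
Hypothesis Z_ident : identically_distributed P Z.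
Variable I : finType.
Implicit Types (phi : nat -> nat -> I) (F : seq I -> R) (n : nat).

Definition path_code phi n (w : T) : seq I := [seq phi t (Z t w) | t <- iota 1 n].

Definition code_law phi (t : nat) (i : I) : R :=
  fine (P [set w | phi t (Z 0%N w) = i]).

Lemma same_law t (A : set nat) : P (Z t @^-1` A) = P (Z 0%N @^-1` A).
Proof. exact: (@Z_ident t 0%N A). Qed.

Lemma measurable_jump t (A : set nat) : measurable (Z t @^-1` A).
Proof. exact: measurable_funPTI. Qed.

(** Independence of the jumps, in the form of a product over positions: a
    letter depends only on its own jump, and every jump has the law of
    Z 0. *)
Lemma path_code_prob phi n (y : n.-tuple I) :
  P [set w | path_code phi n w = y] = (\prod_(k < n) code_law phi k.+1 (tnth y k))%:E.
Proof.
case: n y => [|n] y.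
  rewrite big_ord0 (tuple0 y) (_ : [set _ | _] = setT) ?probability_setT//.
  by apply/seteqP; split.
pose i0 := tnth y ord0.
pose A t := [set z | phi t z = nth i0 y t.-1].
pose J := seq_fset tt (iota 1 n.+1).
have -> : [set w | path_code phi n.+1 w = y] =
    \bigcap_(i in [set` J]) (Z i @^-1` A i).
  apply/seteqP; split => [w /= yw t|w H].
    rewrite /= seq_fsetE mem_iota => /andP[t1 tn].
    rewrite /A /= -yw /path_code (nth_map 0%N) ?size_iota; last by rewrite -ltnS prednK.
    by rewrite nth_iota ?add1n ?prednK// -ltnS prednK.
  apply: (@eq_from_nth _ i0); rewrite /path_code size_map size_iota ?size_tuple// => k kn.
  rewrite (nth_map 0%N) ?size_iota// nth_iota// add1n.
  by have := H k.+1; rewrite /= seq_fsetE mem_iota; apply.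
rewrite Z_indep//.
rewrite (perm_big (iota 1 n.+1)); last first.
  by apply: uniq_perm; [exact: fset_uniq|exact: iota_uniq|exact: seq_fsetE].
rewrite -[iota 1 n.+1]/(index_iota 1 n.+2) big_add1 big_mkord.
rewrite (big_morph EFin EFinM (erefl _)).
apply: eq_bigr => k _; rewrite same_law /code_law fineK ?fin_num_measure//.
- by congr (P _); apply/seteqP; split=> w; rewrite /A /= (tnth_nth i0).
- exact: (measurable_jump 0%N [set z | phi k.+1 z = tnth y k]).
Qed.

Lemma bounded_rv_path_code phi n F : bounded_rv (fun w => F (path_code phi n w)).
Proof.
split.
  apply: (@measurable_path_fun _ _ R P Z n
    (fun z => F [seq phi t (z t) | t <- iota 1 n])) => z1 z2 z12.
  congr F; apply/eq_in_map => t; rewrite mem_iota add1n ltnS => /andP[_ tn].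
  by rewrite z12.
exists (\sum_(y : n.-tuple I) `|F y|) => w.
have sz : size (path_code phi n w) == n by rewrite size_map size_iota.
by rewrite (bigD1 (Tuple sz))//= lerDl sumr_ge0.
Qed.

Lemma measurable_path_code_eq phi n (s : seq I) :
  measurable [set w | path_code phi n w = s].
Proof.
have [mF _] := bounded_rv_path_code phi n (fun s' => (s' == s)%:R).
have := mF measurableT [set 1] (measurable_set1 _); rewrite setTI.
congr measurable; apply/seteqP; split=> w /=.
  by case: eqP => // _ /eqP; rewrite eq_sym oner_eq0.
by move=> ->; rewrite eqxx.
Qed.

(** The bridge from the probability space to finite sums. *)
Lemma mean_path_code phi n F :
  mean P (fun w => F (path_code phi n w)) =
  prod_mean [seq code_law phi t | t <- iota 1 n] F.
Proof.
rewrite prod_meanE /mean expectation.unlock.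
pose A (y : n.-tuple I) : set T := [set w | path_code phi n w = y].
have mA y : measurable (A y) by exact: measurable_path_code_eq.
transitivity (fine (\int[P]_w (\sum_(y : n.-tuple I) (F y * \1_(A y) w)%:E)))%E.
  congr fine; apply: eq_integral => w _; rewrite sumEFin; congr EFin.
  have sz : size (path_code phi n w) == n by rewrite size_map size_iota.
  rewrite (bigD1 (Tuple sz))//= big1 => [|y ysz].
    by rewrite addr0 indicE mem_set ?mulr1.
  rewrite indicE memNset ?mulr0// /A /= => wy; case/eqP: ysz.
  exact: val_inj.
have iA (y : n.-tuple I) : P.-integrable setT (fun w => (F y * \1_(A y) w)%:E).
  apply/Lfun1_integrable; apply: bounded_rv_Lfun; split.
    by apply: measurable_funM => //; exact: measurable_indic.
  exists `|F y| => w; rewrite normrM indicE.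
  by case: (_ \in _); rewrite ?normr1 ?normr0 ?mulr1 ?mulr0.
rewrite integral_sum//.
transitivity (fine (\sum_(y : n.-tuple I)
    ((\prod_(k < n) code_law phi k.+1 (tnth y k)) * F y)%:E)).
  congr fine; apply: eq_bigr => y _.
  under eq_integral do rewrite EFinM.
  rewrite integralZl//; last by apply/Lfun1_integrable/bounded_rv_Lfun/bounded_rv_indic.
  rewrite integral_indic// setIT mulrC EFinM; congr (_ * _)%E.
  exact: path_code_prob.
by rewrite sumEFin.
Qed.

(** The indicators of the values of a letter sum to the constant 1. *)
Lemma is_pmf_code_law phi t : is_pmf (code_law phi t).
Proof.
split=> [i|]; first by rewrite fine_ge0.
have m i : measurable [set w | phi t (Z 0%N w) = i].
  exact: (measurable_jump 0%N [set z | phi t z = i]).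
apply: EFin_inj; rewrite -sumEFin -(expectation_cst P 1) expectation.unlock.
transitivity (\int[P]_w (\sum_i (\1_[set w | phi t (Z 0%N w) = i] w)%:E))%E.
  rewrite ge0_integral_sum//.
  - apply: eq_bigr => i _; rewrite integral_indic// setIT fineK//.
    by rewrite fin_num_measure.
  - by move=> i; apply/measurable_EFinP/measurable_indic.
apply: eq_integral => w _; rewrite sumEFin; congr EFin.
rewrite (bigD1 (phi t (Z 0%N w)))//= big1 => [|i iw].
  by rewrite addr0 indicE mem_set.
by rewrite indicE memNset//= => wi; rewrite wi eqxx in iw.
Qed.

Lemma all_pmf_code_law phi n : all_pmf [seq code_law phi t | t <- iota 1 n].
Proof.
move=> k; rewrite size_map size_iota => kn.
by rewrite (nth_map 0%N) ?size_iota//; exact: is_pmf_code_law.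
Qed.

End path_law.

(** * Roots as boxes *)

Section roots.
Variables (z : nat -> nat) (n K : nat).

Definition old_times : seq nat := [seq t <- iota 1 n | (t <= z t)%N].

Definition root_seq : seq int := undup [seq parent z t | t <- old_times].

(** The ball t, with jump k, falls into the box j when k = t + j, that is, when
    its parent is the root -j; boxes from K on are discarded. *)
Definition box (t k : nat) : option 'I_K := if (t <= k)%N then insub (k - t)%N else None.

Definition hit_boxes : seq 'I_K :=
  [seq j <- enum 'I_K | Some j \in [seq box t (z t) | t <- iota 1 n]].

Lemma mem_root_seq i : (i \in root_seq) = (i \in fset_set (attached_roots z n)).
Proof.
rewrite in_fset_set; last exact: finite_attached_roots.
apply/idP/idP => [|/set_mem [i0 [t tn ti]]].
  rewrite mem_undup => /mapP[t]; rewrite mem_filter mem_iota add1n ltnS.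
  move=> /andP[tz tn] ->; apply/mem_set; split; last by exists t.
  by rewrite /parent subr_le0 lez_nat.
rewrite mem_undup; apply/mapP; exists t => //.
by rewrite mem_filter mem_iota add1n ltnS tn andbT -lez_nat -subr_le0 -/(parent z t) ti.
Qed.

Lemma card_attached_roots :
  #|` fset_set (attached_roots z n)| = size root_seq.
Proof.
apply: perm_size; apply: uniq_perm; [exact: fset_uniq|exact: undup_uniq|].
by move=> i; rewrite mem_root_seq.
Qed.

Lemma card_roots_le_old : (#|` fset_set (attached_roots z n)| <= size old_times)%N.
Proof. by rewrite card_attached_roots (leq_trans (size_undup _))// size_map. Qed.

Lemma hit_boxes_le_card :
  (size hit_boxes <= #|` fset_set (attached_roots z n)|)%N.
Proof.
rewrite card_attached_roots -(size_map (fun j : 'I_K => - (j%:Z))).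
apply: uniq_leq_size.
  rewrite map_inj_uniq; first by rewrite filter_uniq// enum_uniq.
  by move=> i j /oppr_inj [] /val_inj.
move=> _ /mapP[j + ->]; rewrite mem_filter => /andP[/mapP[t tn] + _].
rewrite /box; case: ifPn => // tz /esym; case: insubP => // j' _ jE [<-].
rewrite mem_undup; apply/mapP; exists t; first by rewrite mem_filter tz.
by rewrite /parent jE -subzn// opprB.
Qed.

(** A root that is not among the first K boxes is the parent of some t whose
    jump is at least t + K. *)
Lemma card_le_hit_boxes :
  (#|` fset_set (attached_roots z n)| <=
   size hit_boxes + size [seq t <- iota 1 n | (t + K <= z t)%N])%N.
Proof.
rewrite card_attached_roots -(size_map (fun j : 'I_K => - (j%:Z))).
rewrite -[X in (_ <= _ + X)%N](size_map (parent z)) -size_cat.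
apply: uniq_leq_size; first exact: undup_uniq.
move=> i; rewrite mem_undup => /mapP[t]; rewrite mem_filter => /andP[tz tn] ->.
rewrite mem_cat; have [Kt|tK] := leqP (t + K) (z t).
  by apply/orP; right; apply/map_f; rewrite mem_filter Kt.
apply/orP; left.
have jK : (z t - t < K)%N by rewrite ltn_subLR// addnC.
have -> : parent z t = - ((Ordinal jK : nat)%:Z) by rewrite /= -subzn// opprB.
apply: map_f; rewrite mem_filter mem_enum andbT; apply/mapP; exists t => //.
by rewrite /box tz insubT.
Qed.

End roots.

(** * The law of a jump *)

Section model_facts.
Context d (T : measurableType d) (R : realType) (P : probability T R).
Variable Z : nat -> {RV P >-> nat}.
Hypothesis Z_indep : mutually_independent P Z.
Hypothesis Z_ident : identically_distributed P Z.
Local Notation p := (tail_prob P Z).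
Local Notation m := (trunc_mean P Z).

Definition jump_pmf (k : nat) : R := fine (P [set w | Z 0%N w = k]).

Lemma measurable_jump_ge t c : measurable [set w | (c <= Z t w)%N].
Proof. exact: (measurable_jump Z t [set k | (c <= k)%N]). Qed.

Lemma tail_prob01 n : 0 <= p n <= 1.
Proof.
rewrite /tail_prob fine_ge0//= -lee_fin fineK.
  exact: probability_le1 (measurable_jump_ge _ _).
by rewrite fin_num_measure//; exact: measurable_jump_ge.
Qed.

Lemma prob_jump_ge t c : P [set w | (c <= Z t w)%N] = (p c)%:E.
Proof.
rewrite /tail_prob fineK; last by rewrite fin_num_measure//; exact: measurable_jump_ge.
exact: (same_law Z_ident t [set k | (c <= k)%N]).
Qed.

Lemma tail_prob_nincr a b : (a <= b)%N -> p b <= p a.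
Proof.
move=> ab; rewrite -lee_fin -!(prob_jump_ge 0).
apply: le_measure; rewrite ?inE; try exact: measurable_jump_ge.
by move=> w /=; exact: leq_trans.
Qed.

Lemma tail_probS k : p k = jump_pmf k + p k.+1.
Proof.
have m1 : measurable [set w | Z 0%N w = k].
  exact: (measurable_jump Z 0%N [set k]).
have m2 := measurable_jump_ge 0%N k.+1.
rewrite /tail_prob /jump_pmf -fineD ?fin_num_measure// -measureU//; last first.
  by apply/seteqP; split=> // w [/= ->]; rewrite ltnn.
congr (fine (P _)); apply/seteqP; split=> w /=; last by move=> [->//|/ltnW].
by rewrite leq_eqVlt => /predU1P[->|]; [left|right].
Qed.

Lemma jump_pmf01 k : 0 <= jump_pmf k <= 1.
Proof.
have := tail_probS k; have := tail_prob01 k; have := tail_prob01 k.+1.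
have : 0 <= jump_pmf k by rewrite fine_ge0.
lra.
Qed.

Lemma cvg_tail_prob : p n @[n --> \oo] --> 0.
Proof.
have : P [set w | (n <= Z 0%N w)%N] @[n --> \oo] --> 0%E.
  rewrite -(measure0 P).
  have <- : \bigcap_n [set w | (n <= Z 0%N w)%N] = set0.
    by apply/seteqP; split=> // w /(_ (Z 0%N w).+1 I) /=; rewrite ltnn.
  apply: (@nonincreasing_cvg_mu _ _ _ P (fun n => [set w | (n <= Z 0%N w)%N])) => //.
  - by rewrite (le_lt_trans (probability_le1 _ _)) ?ltry//; exact: measurable_jump_ge.
  - by move=> n; exact: measurable_jump_ge.
  - by apply: bigcap_measurable => // n _; exact: measurable_jump_ge.
  - by move=> a b ab; apply/subsetPset => w /=; exact: leq_trans.
by move/fine_cvg.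
Qed.

(** With c t = t this is the number of balls in boxes; with c t = t + K it is the
    number of balls that fall beyond the first K boxes. *)
Definition count_ge (c : nat -> nat) n (w : T) : R :=
  \sum_(1 <= t < n.+1) \1_[set v | (c t <= Z t v)%N] w.

Lemma count_geE c n w : count_ge c n w =
  (size [seq t <- iota 1 n | (c t <= Z t w)%N])%:R.
Proof.
rewrite /count_ge size_filter -sum1_count natr_sum /index_iota subSS subn0.
rewrite big_mkcond [RHS]big_mkcond; apply: eq_bigr => t _ /=.
rewrite indicE; case: ifPn => tz; first by rewrite mem_set.
by rewrite memNset//=; exact/negP.
Qed.

Lemma bounded_rv_count_ge c n : bounded_rv (count_ge c n).
Proof.
split.
  apply: measurable_sum => t; apply: measurable_indic; exact: measurable_jump_ge.
exists n%:R => w; rewrite count_geE normr_nat ler_nat size_filter.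
by rewrite (leq_trans (count_size _ _))// size_iota.
Qed.

Lemma mean_count_ge c n : mean P (count_ge c n) = \sum_(1 <= t < n.+1) p (c t).
Proof.
rewrite /mean expectation.unlock.
transitivity (fine (\int[P]_w (\sum_(1 <= t < n.+1) (\1_[set v | (c t <= Z t v)%N] w)%:E)))%E.
  by congr fine; apply: eq_integral => w _; rewrite sumEFin.
rewrite ge0_integral_sum//; last first.
  by move=> t; apply/measurable_EFinP/measurable_indic; exact: measurable_jump_ge.
transitivity (fine (\sum_(1 <= t < n.+1) (p (c t))%:E)); last by rewrite sumEFin.
congr fine; apply: eq_bigr => t _.
rewrite integral_indic ?setIT//; [exact: prob_jump_ge|exact: measurable_jump_ge].
Qed.

Lemma mean_num_old n : mean P (num_old P Z n) = m n.
Proof. exact: (mean_count_ge id). Qed.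

Lemma mean_overflow_cvg0 n :
  mean P (count_ge (fun t => t + K)%N n) @[K --> \oo] --> 0.
Proof.
have npK : n%:R * p K @[K --> \oo] --> 0.
  rewrite -[X in _ --> X](mulr0 (n%:R : R)).
  by apply: cvgM; [exact: cvg_cst|exact: cvg_tail_prob].
apply: (squeeze_cvgr _ (cvg_cst 0) npK); near=> K.
rewrite mean_count_ge; apply/andP; split.
  by apply: sumr_ge0 => t _; have /andP[] := tail_prob01 (t + K).
apply: (@le_trans _ _ (\sum_(1 <= t < n.+1) p K)).
  by apply: ler_sum => t _; apply: tail_prob_nincr; rewrite leq_addl.
by rewrite big_const_nat subSS subn0 iter_addr_0 mulr_natl.
Unshelve. all: by end_near. Qed.

End model_facts.

Section infinite_mean.
Context d (T : measurableType d) (R : realType) (P : probability T R).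
Variable Z : nat -> {RV P >-> nat}.
Hypothesis Z_ident : identically_distributed P Z.
Local Notation p := (tail_prob P Z).
Local Notation m := (trunc_mean P Z).

(** Monotone convergence: m n is the mean of the minimum of n and Z 0,
    written as the number of t in 1, ..., n that are at most Z 0. *)
Lemma cvg_trunc_mean : 'E_P[fun w => (Z 0%N w)%:R]%E = +oo%E ->
  m n @[n --> \oo] --> +oo.
Proof.
rewrite expectation.unlock => EZ; apply/cvgeryP; rewrite -EZ.
pose g n w : \bar R := (\sum_(1 <= t < n.+1) \1_[set v | (t <= Z 0%N v)%N] w)%:E.
have mg n : measurable_fun setT (g n).
  apply/measurable_EFinP/measurable_sum => t; apply: measurable_indic.
  exact: measurable_jump_ge.
have g_mono w : {homo g^~ w : a b / (a <= b)%N >-> (a <= b)%E}.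
  move=> a b ab; rewrite lee_fin [leRHS](@big_cat_nat _ _ _ a.+1)//= lerDl.
  by apply: sumr_ge0.
have := @cvg_monotone_convergence _ _ _ P setT measurableT g (fun n => mg n) _ _.
have -> : (fun n => \int[P]_w g n w)%E = (fun n => (m n)%:E).
  apply/funext => n.
  under eq_integral do rewrite /g -sumEFin.
  rewrite ge0_integral_sum//; last first.
    by move=> t; apply/measurable_EFinP/measurable_indic; exact: measurable_jump_ge.
  rewrite /m -sumEFin; apply: eq_bigr => t _.
  rewrite integral_indic ?setIT//; last exact: measurable_jump_ge.
  exact: prob_jump_ge.
have -> : (\int[P]_w limn (g^~ w) = \int[P]_w (Z 0%N w)%:R%:E)%E.
  apply: eq_integral => w _; apply/cvg_lim => //.
  apply: cvg_near_cst; exists (Z 0%N w) => // n /= Zn; congr EFin.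
  rewrite (@big_cat_nat _ _ _ (Z 0%N w).+1)//=.
  have -> : \sum_((Z 0%N w).+1 <= t < n.+1) \1_[set v | (t <= Z 0%N v)%N] w = 0 :> R.
    rewrite big_nat big1// => t /andP[Zt _].
    by rewrite indicE memNset//=; apply/negP; rewrite -ltnNge.
  rewrite addr0 big_nat (eq_bigr (fun=> 1)); last first.
    by move=> t /andP[_ tZ]; rewrite indicE mem_set.
  by rewrite -big_nat big_const_nat subSS subn0 iter_addr_0.
apply => //.
  by move=> n w _; rewrite lee_fin sumr_ge0.
Qed.

End infinite_mean.

(** * The expected number of trees *)

Section trees.
Context d (T : measurableType d) (R : realType) (P : probability T R).
Variable Z : nat -> {RV P >-> nat}.
Hypothesis Z_indep : mutually_independent P Z.
Hypothesis Z_ident : identically_distributed P Z.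
Local Notation p := (tail_prob P Z).
Local Notation m := (trunc_mean P Z).
Local Notation f := (jump_pmf Z).
Implicit Types (n K : nat) (w : T).

Lemma num_trees_le_old n w : num_trees P Z n w <= num_old P Z n w.
Proof.
have -> : num_old P Z n w = count_ge Z id n w by [].
by rewrite count_geE /num_trees ler_nat card_roots_le_old.
Qed.

Lemma bounded_rv_num_old n : bounded_rv (num_old P Z n).
Proof. exact: (bounded_rv_count_ge _ id). Qed.

Lemma bounded_rv_num_trees n : bounded_rv (num_trees P Z n).
Proof.
have [_ [M OM]] := bounded_rv_num_old n; split; first exact: measurable_num_trees.
exists M => w; apply: le_trans (OM w).
have M0 : 0 <= num_trees P Z n w by rewrite /num_trees ler0n.
rewrite !ger0_norm ?num_trees_le_old//.
exact: le_trans (num_trees_le_old n w).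
Qed.

Definition boxes K : seq (option 'I_K) := [seq Some j | j <- enum 'I_K].

Definition num_boxes K n w : R := num_hit R (boxes K) (path_code Z (@box K) n w).

Lemma num_boxesE K n w : num_boxes K n w = (size (hit_boxes (Z^~ w) n K))%:R.
Proof.
rewrite /num_boxes /num_hit big_map size_filter -sum1_count natr_sum.
by rewrite [RHS]big_mkcond; apply: eq_bigr => j _; case: ifP.
Qed.

Lemma num_boxes_le_trees K n w : num_boxes K n w <= num_trees P Z n w.
Proof. by rewrite num_boxesE ler_nat hit_boxes_le_card. Qed.

Lemma num_trees_le_boxes K n w :
  num_trees P Z n w <= num_boxes K n w + count_ge Z (fun t => t + K)%N n w.
Proof. by rewrite num_boxesE count_geE -natrD ler_nat card_le_hit_boxes. Qed.

Lemma bounded_rv_num_boxes K n : bounded_rv (num_boxes K n).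
Proof. exact: (bounded_rv_path_code Z (@box K) n (num_hit R (boxes K))). Qed.

Lemma code_law_box K t (j : 'I_K) : code_law Z (@box K) t (Some j) = f (t + j)%N.
Proof.
congr (fine (P _)); apply/seteqP; split=> w /=; rewrite /box.
  case: ifPn => // tz; case: insubP => // j' _ jE [<-].
  by rewrite jE subnKC.
by move=> ->; rewrite leq_addr addKn valK.
Qed.

Lemma mean_num_boxes K n : mean P (num_boxes K n) =
  \sum_(0 <= j < K) (1 - \prod_(1 <= t < n.+1) (1 - f (t + j)%N)).
Proof.
rewrite (mean_path_code Z_indep Z_ident) prod_mean_num_hit; last exact: all_pmf_code_law.
rewrite big_map big_enum big_mkord /=; apply: eq_bigr => j _.
congr (1 - _); rewrite /avoid_prob big_map /index_iota subSS subn0.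
by apply: eq_bigr => t _; rewrite code_law_box.
Qed.

(** The product is at most exp(-A) <= 1 / (1 + A), which is at most
    1 - A + A^2. *)
Lemma prod_onem_le (a : nat -> R) (s : seq nat) : (forall t, 0 <= a t <= 1) ->
  \prod_(t <- s) (1 - a t) <= 1 - (\sum_(t <- s) a t) * (1 - \sum_(t <- s) a t).
Proof.
move=> a01; set A := \sum_(t <- s) a t.
have A0 : 0 <= A by apply: sumr_ge0 => t _; have /andP[] := a01 t.
have : \prod_(t <- s) (1 - a t) <= expR (- A).
  rewrite /A -sumrN expR_sum; apply: ler_prod => t _.
  have /andP[a0 a1] := a01 t; rewrite subr_ge0 a1 /=.
  exact: expR_ge1Dx.
move/le_trans; apply; rewrite expRN.
have e := expR_ge1Dx A.
apply: (@le_trans _ _ (1 + A)^-1).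
  by rewrite lef_pV2 ?posrE ?expR_gt0//; lra.
rewrite -[leLHS]div1r ler_pdivrMr; last lra.
rewrite -subr_ge0 (_ : _ - _ = A ^+ 3); last by ring.
exact: exprn_ge0.
Qed.

(** The expected number of balls in a box telescopes; in particular it is at
    most p j.+1. *)
Lemma box_mass n j : \sum_(1 <= t < n.+1) f (t + j)%N = p j.+1 - p (n + j).+1.
Proof.
elim: n => [|n IH]; first by rewrite big_nil add0n subrr.
rewrite big_nat_recr//= IH addSn.
have := tail_probS Z (n + j).+1; lra.
Qed.

Lemma box_mass_total K n :
  \sum_(0 <= j < K) \sum_(1 <= t < n.+1) f (t + j)%N =
  m n - mean P (count_ge Z (fun t => t + K)%N n).
Proof.
rewrite exchange_big (mean_count_ge Z_ident) /m -sumrB; apply: eq_bigr => t _ /=.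
elim: K => [|K IH]; first by rewrite big_nil addn0 subrr.
rewrite big_nat_recr//= IH addnS.
have := tail_probS Z (t + K); lra.
Qed.

Lemma mean_num_trees_le n : mean P (num_trees P Z n) <= m n.
Proof.
rewrite -(mean_num_old Z_ident).
apply: le_mean; [exact: bounded_rv_num_trees|exact: bounded_rv_num_old|].
by move=> w; exact: num_trees_le_old.
Qed.

(** The box j is occupied with probability at least A_j - A_j p_(j+1), where A_j
    is the expected number of its balls.  The A_j sum to m n up to the balls that
    fall beyond K, and p_(j+1) <= e from some N on.  The bound is obtained for
    each K and passes to the limit. *)
Lemma mean_num_trees_ge (e : R) : 0 < e -> exists N : nat, forall n,
  m n - mean P (num_trees P Z n) <= N%:R + e * m n.
Proof.
move=> e0.
have [N _ Ne] : \forall n \near \oo, p n <= e.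
  move/cvgr0Pnorm_le : (cvg_tail_prob Z) => /(_ e e0); apply: filterS => n.
  exact: le_trans (ler_norm _).
exists N => n; rewrite lerBlDr.
pose ov K := mean P (count_ge Z (fun t => t + K)%N n).
pose C := N%:R + e * m n + mean P (num_trees P Z n).
have ovC : C + ov K @[K --> \oo] --> C.
  rewrite -[X in _ --> X]addr0; apply: cvgD; first exact: cvg_cst.
  exact: mean_overflow_cvg0.
apply: (cvgr_to_ge ovC).
near=> K.
have MK : mean P (num_boxes K n) <= mean P (num_trees P Z n).
  apply: le_mean => [||w]; [exact: bounded_rv_num_boxes|exact: bounded_rv_num_trees|].
  exact: num_boxes_le_trees.
pose A j := \sum_(1 <= t < n.+1) f (t + j)%N.
have A0 j : 0 <= A j by apply: sumr_ge0 => t _; have /andP[] := jump_pmf01 Z (t + j).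
have Ap j : A j <= p j.+1.
  by rewrite /A box_mass gerBl; have /andP[] := tail_prob01 Z (n + j).+1.
have p1 j : p j <= 1 by have /andP[] := tail_prob01 Z j.
have box j : A j - A j * p j.+1 <= 1 - \prod_(1 <= t < n.+1) (1 - f (t + j)%N).
  have := @prod_onem_le (fun t => f (t + j)%N) (index_iota 1 n.+1) (fun t => jump_pmf01 Z _).
  rewrite -/(A j) => H.
  have : A j * A j <= A j * p j.+1 by rewrite ler_wpM2l.
  lra.
have sumA : \sum_(0 <= j < K) A j = m n - ov K by exact: box_mass_total.
have A01 j : 0 <= A j <= 1 by rewrite A0 (le_trans (Ap j)).
have p01 j : 0 <= p j.+1 <= 1 by exact: tail_prob01.
have pN j : (N <= j)%N -> p j.+1 <= e by move=> Nj; apply: Ne => /=; exact: leqW.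
have := sum_mul_small K A01 p01 pN (ltW e0); rewrite sumA.
have : \sum_(0 <= j < K) (A j - A j * p j.+1) <= mean P (num_boxes K n).
  by rewrite mean_num_boxes; apply: ler_sum => j _; exact: box.
rewrite sumrB sumA.
have ov0 : 0 <= e * ov K.
  rewrite mulr_ge0 ?(ltW e0)//; apply: mean_ge0 => w.
  by rewrite count_geE ler0n.
rewrite /C; lra.
Unshelve. all: by end_near. Qed.

End trees.

(** * Chernoff bounds for the number of trees *)

Section chernoff.
Context d (T : measurableType d) (R : realType) (P : probability T R).
Variable Z : nat -> {RV P >-> nat}.
Hypothesis Z_indep : mutually_independent P Z.
Hypothesis Z_ident : identically_distributed P Z.
Local Notation EM n := (mean P (num_trees P Z n)).
Implicit Types (n K : nat) (w : T) (lam a : R).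

(** The expected number of balls that fall beyond the first K boxes. *)
Let ov n K := mean P (count_ge Z (fun t => t + K)%N n).

Lemma bounded_rv_expR_boxes lam a K n :
  bounded_rv (fun w => expR (- (lam * a)) * expR (lam * num_boxes Z K n w) : R).
Proof.
exact: (bounded_rv_path_code Z (@box K) n
  (fun s => expR (- (lam * a)) * expR (lam * num_hit R (boxes K) s))).
Qed.

Lemma mean_expR_boxes lam a K n :
  mean P (fun w => expR (- (lam * a)) * expR (lam * num_boxes Z K n w)) <=
  expR (- (lam * a) + (expR lam - 1) * mean P (num_boxes Z K n)).
Proof.
have pq : all_pmf [seq code_law Z (@box K) t | t <- iota 1 n].
  exact: all_pmf_code_law.
rewrite (mean_path_code Z_indep Z_ident (@box K) n
  (fun s => expR (- (lam * a)) * expR (lam * num_hit R (boxes K) s))).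
rewrite prod_meanZ expRD ler_wpM2l ?expR_ge0//.
rewrite (mean_path_code Z_indep Z_ident (@box K) n (num_hit R (boxes K))).
apply: prod_mean_expR_num_hit => //.
rewrite map_inj_uniq ?enum_uniq//; exact: Some_inj.
Qed.

Lemma mean_num_boxes_le K n : mean P (num_boxes Z K n) <= EM n.
Proof.
apply: le_mean => [||w]; [exact: bounded_rv_num_boxes|exact: bounded_rv_num_trees|].
exact: num_boxes_le_trees.
Qed.

Lemma mean_num_boxes_ge K n : EM n - ov n K <= mean P (num_boxes Z K n).
Proof.
rewrite -meanB; [|exact: bounded_rv_num_trees|exact: bounded_rv_count_ge].
apply: le_mean => [||w].
- by apply: bounded_rvB; [exact: bounded_rv_num_trees|exact: bounded_rv_count_ge].
- exact: bounded_rv_num_boxes.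
- by rewrite /= lerBlDr num_trees_le_boxes.
Qed.

Lemma measurable_trees_gt n a : measurable [set w | a < num_trees P Z n w].
Proof.
have := @measurable_funPTI _ _ _ _ (num_trees P Z n) `]a, +oo[%classic (measurable_itv _).
congr measurable; apply/seteqP.
by split=> w /=; rewrite in_itv/= andbT.
Qed.

Lemma measurable_trees_lt n a : measurable [set w | num_trees P Z n w < a].
Proof.
have := @measurable_funPTI _ _ _ _ (num_trees P Z n) `]-oo, a[%classic (measurable_itv _).
by congr measurable; apply/seteqP; split.
Qed.

(** Off the event that some ball falls beyond the first K boxes, all trees are
    counted by the boxes and Markov's inequality applies to them; the probability
    of that event is at most the expected number of such balls, which vanishes as
    K -> oo. *)
Lemma chernoff_upper n lam a : 0 <= lam ->
  fine (P [set w | a < num_trees P Z n w]) <=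
  expR (- (lam * a) + (expR lam - 1) * EM n).
Proof.
move=> l0; set b := expR _; set A := [set w | _].
have mA : measurable A by exact: measurable_trees_gt.
have bC : b + ov n K @[K --> \oo] --> b.
  rewrite -[X in _ --> X]addr0; apply: cvgD; first exact: cvg_cst.
  exact: mean_overflow_cvg0.
apply: (cvgr_to_ge bC); near=> K.
rewrite -lerBlDr -(mean_indic P mA) -meanB; last 2 first.
- exact: bounded_rv_indic.
- exact: bounded_rv_count_ge.
apply: (@le_trans _ _
  (mean P (fun w => expR (- (lam * a)) * expR (lam * num_boxes Z K n w)))).
  apply: le_mean => [||w].
  - by apply: bounded_rvB; [exact: bounded_rv_indic|exact: bounded_rv_count_ge].
  - exact: bounded_rv_expR_boxes.
  rewrite /= lerBlDr indicE -expRD.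
  case: (boolP (w \in A)) => [/set_mem wA|_]; last first.
    by rewrite addr_ge0 ?expR_ge0// count_geE ler0n.
  have := num_trees_le_boxes Z K n w; rewrite /A /= in wA.
  rewrite count_geE; case: (size _) => [|k]; last first.
    by move=> _; rewrite -[1%:R]add0r lerD ?expR_ge0// ler_nat.
  rewrite !addr0 => /(lt_le_trans wA) aK.
  rewrite -expR0 ler_expR addrC -mulrBr mulr_ge0// subr_ge0; exact: ltW.
apply: le_trans (mean_expR_boxes _ _ _ _) _; rewrite ler_expR lerD2l.
by rewrite ler_wpM2l ?mean_num_boxes_le// subr_ge0 -expR0 ler_expR.
Unshelve. all: by end_near. Qed.

(** The number of occupied boxes among the first K is at most the number of
    trees, so it inherits a lower deviation; K -> oo replaces its mean by that of
    the number of trees. *)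
Lemma chernoff_lower n lam a : lam <= 0 ->
  fine (P [set w | num_trees P Z n w < a]) <=
  expR (- (lam * a) + (expR lam - 1) * EM n).
Proof.
move=> l0; set b := expR _; set A := [set w | _].
have mA : measurable A by exact: measurable_trees_lt.
have bC : expR (- (lam * a) + (expR lam - 1) * (EM n - ov n K)) @[K --> \oo] --> b.
  apply: (continuous_cvg _ (@continuous_expR R _)).
  apply: cvgD; first exact: cvg_cst.
  apply: cvgM; first exact: cvg_cst.
  rewrite -[X in _ --> X]subr0; apply: cvgB; first exact: cvg_cst.
  exact: mean_overflow_cvg0.
apply: (cvgr_to_ge bC); near=> K.
rewrite -(mean_indic P mA).
apply: (@le_trans _ _
  (mean P (fun w => expR (- (lam * a)) * expR (lam * num_boxes Z K n w)))).
  apply: le_mean => [||w].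
  - exact: bounded_rv_indic.
  - exact: bounded_rv_expR_boxes.
  rewrite indicE -expRD.
  case: (boolP (w \in A)) => [/set_mem wA|_]; last exact: expR_ge0.
  rewrite -[1%:R]expR0 ler_expR addrC -mulrBr mulr_le0// subr_le0.
  by apply: le_trans (num_boxes_le_trees Z K n w) _; exact: ltW.
apply: le_trans (mean_expR_boxes _ _ _ _) _; rewrite ler_expR lerD2l.
by rewrite ler_wnM2l ?mean_num_boxes_ge// subr_le0 expR_le1.
Unshelve. all: by end_near. Qed.

End chernoff.

(** * The limit theorems and the tail bounds *)

Lemma expRN_le_quadratic (R : realType) (l : R) : 0 <= l ->
  expR (- l) <= 1 - l + l ^+ 2 / 2.
Proof.
move=> l0; pose h (t : R) := t ^+ 2 / 2 - t - expR (- t).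
have dh (t : R) : is_derive t 1 h (t - 1 + expR (- t)).
  rewrite /h; apply: is_derive_eq.
  by rewrite /GRing.scale/= !mulr0; field.
have [xi _] := mean_value 0 l dh.
have h0 : 0 <= xi - 1 + expR (- xi).
  by have := expR_ge1Dx (- xi); lra.
rewrite /h add0r expr0n /= mul0r oppr0 expR0 => e.
have : 0 <= l * (xi - 1 + expR (- xi)) by rewrite mulr_ge0.
rewrite -e; lra.
Qed.

Section conclusions.
Context d (T : measurableType d) (R : realType) (P : probability T R).
Variable Z : nat -> {RV P >-> nat}.
Hypothesis Z_gt0 : forall n w, (0 < Z n w)%N.
Hypothesis Z_indep : mutually_independent P Z.
Hypothesis Z_ident : identically_distributed P Z.
Local Notation p := (tail_prob P Z).
Local Notation m := (trunc_mean P Z).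
Local Notation EM n := (mean P (num_trees P Z n)).

(** The letter at time t is the Boolean t <= Z t, whose law is Bernoulli with
    parameter p t. *)
Lemma std_old_cdf n (x : R) : cdf (std_old P Z n : {RV P >-> R}) x =
  (std_count_cdf [seq p t | t <- index_iota 1 n.+1] x)%:E.
Proof.
pose phi t k := (t <= k)%N.
pose F (s : seq bool) : R :=
  (((count id s)%:R - m n) / Num.sqrt (m n) <= x)%R%:R.
pose A : set T := [set w | std_old P Z n w <= x].
have mA : measurable A.
  have := @measurable_funPTI _ _ _ _ (std_old P Z n) `]-oo, x]%classic (measurable_itv _).
  by congr measurable; apply/seteqP; split.
have -> : cdf (std_old P Z n : {RV P >-> R}) x = P A.
  by congr (P _); apply/seteqP; split.
rewrite -[LHS]fineK ?fin_num_measure//; congr EFin.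
rewrite -(mean_indic P mA).
have -> : \1_A = (fun w => F (path_code Z phi n w)) :> (T -> R).
  apply/funext => w.
  have oldE : (count id (path_code Z phi n w))%:R = num_old P Z n w.
    have -> : num_old P Z n w = count_ge Z id n w by [].
    by rewrite count_geE size_filter count_map.
  rewrite /F oldE -/(std_old P Z n w).
  by rewrite indicE; congr ((nat_of_bool _)%:R); apply/idP/idP => [/set_mem//|wx]; exact/mem_set.
rewrite (mean_path_code Z_indep Z_ident phi n F) /std_count_cdf big_map.
rewrite -map_comp /index_iota subSS subn0.
have -> : [seq code_law Z phi t | t <- iota 1 n] =
          [seq (@bernoulli_pmf R \o p) t | t <- iota 1 n].
  apply: eq_map => t; apply/funext => b.
  have pt : code_law Z phi t true = p t.
    by congr (fine (P _)); apply/seteqP; split=> w /=; rewrite /phi.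
  have [_] := is_pmf_code_law Z phi t.
  rewrite big_bool /= pt => e; case: b => //=; lra.
apply: eq_prod_mean => s.
by rewrite /F /trunc_mean /index_iota subSS subn0.
Qed.

(** The vertex 1 is always attached to a root, because jumps are positive. *)
Lemma mean_num_trees_ge1 n : (0 < n)%N -> 1 <= EM n.
Proof.
move=> n0; have <- : mean P (cst 1) = 1 by rewrite /mean expectation_cst.
apply: le_mean => [||w]; [|exact: bounded_rv_num_trees|].
  by split; [exact: measurable_cst|exists 1 => w; rewrite normr1].
rewrite /= /num_trees ler1n card_attached_roots lt0n size_eq0; apply/eqP => r0.
suff : parent (Z^~ w) 1 \in root_seq (Z^~ w) n by rewrite r0.
by rewrite mem_undup map_f// mem_filter mem_iota/= Z_gt0 add1n ltnS.
Qed.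

Lemma num_trees_upper_tail n (x : R) : (0 < n)%N -> 0 < x ->
  (P [set w | (EM n + x < num_trees P Z n w)%R] <=
   ((EM n / (EM n + x)) `^ (EM n + x) * expR x)%:E)%E.
Proof.
move=> n0 x0; have EM1 := mean_num_trees_ge1 n0.
rewrite -[leLHS]fineK ?fin_num_measure//; last exact: measurable_trees_gt.
rewrite lee_fin.
set M := EM n in EM1 *; have M0 : 0 < M by lra.
(* This value of lam minimises the Chernoff bound. *)
pose lam := ln ((M + x) / M).
have r1 : 1 <= (M + x) / M by rewrite ler_pdivlMr//; lra.
have eL : expR lam = (M + x) / M by rewrite lnK// posrE; lra.
apply: le_trans (chernoff_upper Z_indep Z_ident n (M + x) (ln_ge0 r1)) _.
rewrite -/lam -/M eL (_ : ((M + x) / M - 1) * M = x); last by field; rewrite gt_eqF.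
rewrite expRD ler_wpM2r ?expR_ge0// /powR gt_eqF; last by rewrite divr_gt0//; lra.
rewrite ler_expR -invf_div lnV ?posrE; last by lra.
by rewrite mulrN mulrC.
Qed.

Lemma num_trees_lower_tail n (x : R) : (0 < n)%N -> 0 < x ->
  (P [set w | (num_trees P Z n w < EM n - x)%R] <=
   (expR (- (x ^+ 2 / (2 * EM n))))%:E)%E.
Proof.
move=> n0 x0; have EM1 := mean_num_trees_ge1 n0.
rewrite -[leLHS]fineK ?fin_num_measure//; last exact: measurable_trees_lt.
rewrite lee_fin.
set M := EM n in EM1 *; have M0 : 0 < M by lra.
pose l := x / M; have l0 : 0 < l by rewrite divr_gt0.
have nl0 : - l <= 0 by lra.
apply: le_trans (chernoff_lower Z_indep Z_ident n (M - x) nl0) _.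
rewrite -/M ler_expR.
have eL : expR (- l) <= 1 - l + l ^+ 2 / 2.
  exact/expRN_le_quadratic/ltW.
have xE : x = l * M by rewrite /l divfK// gt_eqF.
apply: (@le_trans _ _ (- (- l * (M - x)) + (- l + l ^+ 2 / 2) * M)).
  rewrite lerD2l; apply: ler_wpM2r; first exact: ltW.
  lra.
rewrite le_eqVlt; apply/orP; left; apply/eqP.
by rewrite /l; field; rewrite gt_eqF.
Qed.

Hypothesis EZ : 'E_P[fun w => (Z 0%N w)%:R]%E = +oo%E.

Let moo : m n @[n --> \oo] --> +oo.
Proof. exact: cvg_trunc_mean. Qed.

Let mgt (a : R) : \forall n \near \oo, a < m n.
Proof. by move/cvgryPgt : moo; exact. Qed.

Lemma cvg_std_old : cvg_in_distribution P (std_old P Z) (normal_prob 0 1).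
Proof.
move=> x _; rewrite [X in _ --> X](gauss_cdfE x).
rewrite (_ : (fun n => _) =
  (fun n => (std_count_cdf [seq p t | t <- index_iota 1 n.+1] x)%:E)).
  apply: cvg_EFin; first by near=> n.
  apply: bernoulli_clt => //; [exact: tail_prob01|exact: cvg_tail_prob].
by apply/funext => n; rewrite std_old_cdf.
Unshelve. all: by end_near. Qed.

Lemma cvg_lost_ratio : (m n - EM n) / m n @[n --> \oo] --> 0.
Proof.
apply: cvg_ratio0 => // e e0.
have [N HN] := mean_num_trees_ge Z_indep Z_ident e0.
exists N => n; rewrite ger0_norm//.
by rewrite subr_ge0 mean_num_trees_le.
Qed.

(** As E M_n is between (1 - eps / 2) m n and m n for large n, a deviation of
    the ratio by eps forces a deviation of M_n from its mean by at least
    eps E M_n above or (eps / 2) m n below; the Chernoff bounds with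
    exp lam = 1 + eps / 2 and lam = - eps / 2 decay exponentially in m n. *)
Lemma cvg_tree_ratio : cvg_in_probability P (tree_ratio P Z) (cst 1).
Proof.
move=> eps e0.
(* c1 and c2 are the rates of the upper and of the lower Chernoff bound; in c1,
   the last factor 1/2 comes from E M_n >= m n / 2. *)
pose c1 := (eps / 2) ^+ 2 / (1 + eps / 2) / 2; pose c2 := eps ^+ 2 / 8.
have c10 : 0 < c1 by rewrite !divr_gt0// ?exprn_gt0 ?divr_gt0//; lra.
have c20 : 0 < c2 by rewrite divr_gt0// exprn_gt0.
have mA n : measurable [set w | eps < `|tree_ratio P Z n w - cst 1 w|].
  have mf : measurable_fun setT (fun w => `|tree_ratio P Z n w - cst 1 w|).
    apply: measurableT_comp => //; exact: measurable_funB.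
  have := mf measurableT `]eps, +oo[%classic (measurable_itv _).
  rewrite setTI; congr measurable; apply/seteqP.
  by split=> w /=; rewrite in_itv/= andbT.
have expm c : 0 < c -> expR (- (c * m n)) @[n --> \oo] --> 0.
  move=> c0; apply/cvgr0Pnorm_le => r r0; near=> n.
  have mn : (c * r)^-1 < m n by near: n; exact: mgt.
  rewrite ger0_norm ?expR_ge0// expRN invf_ple ?posrE ?expR_gt0//.
  have := expR_ge1Dx (c * m n).
  have : r^-1 <= c * m n.
    by rewrite mulrC -ler_pdivrMr// -invfM mulrC ltW.
  lra.
apply: cvg_EFin; first by apply: nearW => n; rewrite fin_num_measure//; exact: mA.
have sum0 : expR (- (c1 * m n)) + expR (- (c2 * m n)) @[n --> \oo] --> 0.
  by rewrite -[X in _ --> X]addr0; apply: cvgD; exact: expm.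
pose d1 := Num.min (eps / 2) (1 / 2).
have d10 : 0 < d1 by rewrite lt_min !divr_gt0.
apply: (squeeze_cvgr _ (cvg_cst 0) sum0); near=> n.
rewrite fine_ge0//=.
have m0 : 0 < m n by near: n; exact: mgt.
have r1 : `|(m n - EM n) / m n| <= d1.
  by near: n; move/cvgr0Pnorm_le : cvg_lost_ratio; apply.
have {}r1 : m n - EM n <= d1 * m n.
  by rewrite -ler_pdivrMr//; apply: le_trans r1; exact: ler_norm.
have dE : d1 <= eps / 2 by rewrite ge_min lexx.
have dH : d1 <= 1 / 2 by rewrite ge_min lexx orbT.
have EMh : m n / 2 <= EM n by nra.
have EMe : (1 - eps / 2) * m n <= EM n by nra.
have EMm : EM n <= m n by exact: mean_num_trees_le.
pose up := [set w | EM n + eps * EM n < num_trees P Z n w].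
pose lo := [set w | num_trees P Z n w < EM n - eps / 2 * m n].
have mup : measurable up by exact: measurable_trees_gt.
have mlo : measurable lo by exact: measurable_trees_lt.
apply: (@le_trans _ _ (fine (P up) + fine (P lo))).
  rewrite -fineD ?fin_num_measure// fine_le ?fin_num_measure//; last first.
  - apply: le_trans (measureU2 _ mup mlo); apply: le_measure; rewrite ?inE//.
      exact: measurableU.
    move=> w /=; rewrite /tree_ratio ltr_normr => /orP[H|H]; [left|right]; rewrite /up /lo/=.
      have : (1 + eps) * m n < num_trees P Z n w by rewrite -ltr_pdivlMr//; lra.
      have : eps * EM n <= eps * m n by rewrite ler_wpM2l// ltW.
      lra.
    have : num_trees P Z n w < (1 - eps) * m n by rewrite -ltr_pdivrMr//; lra.
    lra.
  - by rewrite fin_numD !fin_num_measure.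
apply: lerD.
  have q1 : 1 <= 1 + eps / 2 by lra.
  apply: le_trans (chernoff_upper Z_indep Z_ident n _ (ln_ge0 q1)) _.
  rewrite ler_expR lnK ?posrE; last lra.
  have q0 : 0 < 1 + eps / 2 by lra.
  have := ln_ge_1BV q0; set L := ln _ => HL.
  have : (1 - (1 + eps / 2)^-1) * ((1 + eps) * EM n) <= L * ((1 + eps) * EM n).
    apply: ler_wpM2r => //; rewrite mulr_ge0//; lra.
  have : c1 * m n <= (2 * c1) * EM n.
    by rewrite -mulrA mulrCA ler_wpM2l ?(ltW c10)//; lra.
  have -> : (1 - (1 + eps / 2)^-1) * ((1 + eps) * EM n) =
            eps / 2 * EM n + 2 * c1 * EM n.
    by rewrite /c1; field; rewrite gt_eqF//; lra.
  lra.
have l0 : - (eps / 2) <= 0 by lra.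
apply: le_trans (chernoff_lower Z_indep Z_ident n _ l0) _.
rewrite ler_expR.
have e20 : 0 <= eps / 2 by lra.
have := expRN_le_quadratic e20; set E := expR _ => HE.
have : (E - 1) * EM n <= (- (eps / 2) + (eps / 2) ^+ 2 / 2) * EM n.
  by apply: ler_wpM2r; [lra|lra].
have : (eps / 2) ^+ 2 / 2 * EM n <= (eps / 2) ^+ 2 / 2 * m n.
  by apply: ler_wpM2l => //; rewrite divr_ge0 ?exprn_ge0.
rewrite /c2.
rewrite (_ : eps ^+ 2 / 8 = (eps / 2) ^+ 2 / 2); last by field.
have -> : - (- (eps / 2) * (EM n - eps / 2 * m n)) =
  eps / 2 * EM n - (eps / 2) ^+ 2 * m n by ring.
set q := (eps / 2) ^+ 2.
lra.
Unshelve. all: by end_near. Qed.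

End conclusions.

Theorem proposition2 (d : measure_display) (T : measurableType d)
    (R : realType) (P : probability T R) (Z : nat -> {RV P >-> nat})
    (Z_gt0 : forall (n : nat) (w : T), (0 < Z n w)%N)
    (Z_indep : mutually_independent P Z)
    (Z_ident : identically_distributed P Z) :
  [/\ (* (i) *)
      forall n : nat, (0 < n)%N ->
        'E_P[num_old P Z n]%E = (trunc_mean P Z n)%:E,
      (* (ii) *)
      'E_P[fun w => (Z 0%N w)%:R]%E = +oo%E ->
        cvg_in_distribution P (std_old P Z) (normal_prob 0 1),
      (* (iii) *)
      (forall (n : nat) (w : T), (0 < n)%N ->
          num_trees P Z n w <= num_old P Z n w)
      /\ ('E_P[fun w => (Z 0%N w)%:R]%E = +oo%E ->
          (fun n => fine 'E_P[num_old P Z n \- num_trees P Z n]%E : R^o) =o_\oo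
          (fun n => trunc_mean P Z n : R^o)),
      (* (iv) *)
      'E_P[fun w => (Z 0%N w)%:R]%E = +oo%E ->
        cvg_in_probability P (tree_ratio P Z) (cst 1)
    & (* (v) *)
      forall (n : nat) (x : R), (0 < n)%N -> 0 < x ->
        let EM := fine 'E_P[num_trees P Z n]%E in
        (P [set w | (EM + x < num_trees P Z n w)%R] <=
         ((EM / (EM + x)) `^ (EM + x) * expR x)%:E)%E
        /\ (P [set w | (num_trees P Z n w < EM - x)%R] <=
            (expR (- (x ^+ 2 / (2 * EM))))%:E)%E ].
Proof.
split.
- move=> n _; rewrite meanE ?mean_num_old//; exact: bounded_rv_num_old.
- exact: cvg_std_old.
- split=> [n w _|EZ]; first exact: num_trees_le_old.
  apply/eqoP => e e0.
  have lost0 := cvg_lost_ratio Z_indep Z_ident EZ.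
  have moo := cvg_trunc_mean Z_ident EZ.
  near=> n.
  have m0 : 0 < trunc_mean P Z n by near: n; move/cvgryPgt : moo; exact.
  have : `|(trunc_mean P Z n - mean P (num_trees P Z n)) / trunc_mean P Z n| <= e.
    by near: n; move/cvgr0Pnorm_le : lost0; exact.
  rewrite normrM normfV ler_pdivrMr ?normr_gt0 ?gt_eqF//.
  rewrite -(mean_num_old Z_ident) -meanB//; first exact: bounded_rv_num_old.
  exact: bounded_rv_num_trees.
- exact: cvg_tree_ratio.
- move=> n x n0 x0; split.
    exact: num_trees_upper_tail.
  exact: num_trees_lower_tail.
Unshelve. all: by end_near. Qed.
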